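(* Let $s\ge1$, let $N_1,\dots,N_s\ge2$ be pairwise coprime integers, let $\mathcal S$ be the multiplicative monoid generated by $N_1,\dots,N_s$, put $M=N_s$, and let $\mathcal S'$ be the monoid generated by $N_1,\dots,N_{s-1}$. For $\sigma\in M^0(\mathbb T)$ with $M_*\sigma=\sigma$ we have $$\Psi_{\mathcal S'}(\Omega_{\mathcal S'}(\sigma))=\Psi_{\mathcal S}(\Omega_{\mathcal S}(\sigma)).$$ Correspondingly, if a function $u\in\mathcal N^1$ satisfies the functional equation $u(z^M)^M=\prod_{\zeta^M=1}u(\zeta z)$, then $\Psi_{\mathcal S'}(\Omega_{\mathcal S'}(u))=\Psi_{\mathcal S}(\Omega_{\mathcal S}(u))$.
   Context: $\mathbb T$ is the unit circle, $D$ the open unit disc, $\varphi_N(\zeta)=\zeta^N$. $M^0(\mathbb T)$ is the space of finite real Borel measures on $\mathbb T$ with total mass $0$; $N_*\sigma=(\varphi_N)_*\sigma$; $\zeta_*\sigma$ denotes push-forward under rotation by $\zeta\in\mathbb T$. For $N\ge1$, $(N^*\sigma)(E)=\frac1N\sum_{k=0}^{N-1}\sigma(\varphi_N(E\cap I_k))$ with $I_k=\{e^{i\theta}:\tfrac{2\pi k}N\le\theta<\tfrac{2\pi(k+1)}N\}$. Let $\mathcal T$ denote either of the monoids $\mathcal S$, $\mathcal S'$, with generators $N_1,\dots,N_t$, $t=s$ or $t=s-1$ (if $t=0$ then $\mathcal T=\{1\}$ and $\Omega_{\mathcal T},\Psi_{\mathcal T}$ are the identity/inclusion maps). On measures: $\Omega_{\mathcal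 T}(\sigma)=\prod_{i=1}^t(1-e_i)\sigma$ with commuting operators $e_i\sigma=\frac1{N_i}\sum_{\zeta^{N_i}=1}\zeta_*\sigma$; and $\Psi_{\mathcal T}(\sigma)$ is the set function on arcs $C$ (connected subsets of $\mathbb T$) given by the absolutely convergent series $\Psi_{\mathcal T}(\sigma)(C)=\sum_{N\in\mathcal T}(N^*\sigma)(C)$. On functions: $\mathcal N$ is the Nevanlinna class (quotients $g/h$ of bounded analytic functions on $D$ with $h$ zero-free) and $\mathcal N^1=\{u\in\mathcal N^\times:u(0)=1\}$. For zero-free analytic $u$ on $D$ with $u(0)=1$, $u^{e_i}$ is the unique analytic function with $(u^{e_i})^{N_i}=\prod_{\zeta^{N_i}=1}u(\zeta z)$ and $u^{e_i}(0)=1$; $\Omega_{\mathcal T}(u)$ is obtained from $u$ by successively applying the commuting operators $v\mapsto v/v^{e_i}$, $i=1,\dots,t$; and $\Psi_{\mathcal T}(u)(z)=\prod_{N\in\mathcal T}u(z^N)$, which converges locally uniformly on $D$. *)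

(* Defs.v *)
From HB Require Import structures.
From mathcomp Require Import all_boot all_order all_algebra.
From mathcomp Require Import complex.
From mathcomp Require Import all_classical all_reals all_analysis.

Set Implicit Arguments.
Unset Strict Implicit.
Unset Printing Implicit Defensive.

Import Order.TTheory GRing.Theory Num.Theory.
Import numFieldNormedType.Exports.

Local Open Scope classical_set_scope.
Local Open Scope ring_scope.
Local Open Scope complex_scope.

(* R[i] as a normed space over itself. *)
HB.instance Definition _ (R : rcfType) := PseudoPointedMetric.copy R[i] R[i]^o.
HB.instance Definition _ (R : rcfType) := GRing.ComAlgebra.copy R[i] R[i]^o.
HB.instance Definition _ (R : rcfType) := Vector.copy R[i] R[i]^o.
HB.instance Definition _ (R : rcfType) := NormedModule.copy R[i] R[i]^o.

(* The generators are indexed from 1: only N 1, ..., N t are used. *)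
Definition gen_monoid (N : nat -> nat) (t : nat) : set nat :=
  smallest [set A : set nat | A 1%N /\ forall m n, A m -> A n -> A (m * n)%N]
           [set N i | i in [set i | (1 <= i <= t)%N]].

Section circle.
Variable R : realType.

Record circle := Circle {
  circle_val : R[i];
  circle_valP : `|circle_val| == 1 }.

HB.instance Definition _ := [isSub for circle_val].
HB.instance Definition _ := [Choice of circle by <:].

Lemma circle_val1 (z : circle) : `|circle_val z| = 1.
Proof. by apply/eqP; exact: circle_valP. Qed.

Definition circle_one : circle := Circle (introT eqP (normr1 _)).

Lemma circle_mul_subproof (w z : circle) :
  `|circle_val w * circle_val z| == 1.
Proof. by rewrite normrM !circle_val1 mulr1. Qed.

Definition circle_mul (w z : circle) : circle :=
  Circle (circle_mul_subproof w z).

Lemma circle_pow_subproof (n : nat) (z : circle) :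
  `|circle_val z ^+ n| == 1.
Proof. by rewrite normrX circle_val1 expr1n. Qed.

Definition circle_pow (n : nat) (z : circle) : circle :=
  Circle (circle_pow_subproof n z).

HB.instance Definition _ := isPointed.Build circle circle_one.
HB.instance Definition _ :=
  Topological.copy circle (initial_topology circle_val).
HB.instance Definition _ :=
  Measurable.copy circle (g_sigma_algebraType (@open circle)).

Definition circle_sector (n k : nat) : set circle :=
  [set z | exists theta : R,
     [/\ 2 * pi * k%:R / n%:R <= theta, theta < 2 * pi * k.+1%:R / n%:R
       & circle_val z = cos theta +i* sin theta]].

End circle.

Section measures.
Variable R : realType.
Local Open Scope ereal_scope.
Local Notation T := (circle R).
Implicit Types sigma : set T -> \bar R.

Definition circle_roots (n : nat) : set T :=
  [set zeta | circle_pow n zeta = circle_one R].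

Definition meas_avg (n : nat) sigma : set T -> \bar R :=
  fun A => (n%:R^-1)%:E *
    \sum_(zeta \in circle_roots n) pushforward sigma (circle_mul zeta) A.

Fixpoint Omega_meas (N : nat -> nat) (t : nat) sigma : set T -> \bar R :=
  if t is t'.+1 then
    let tau := Omega_meas N t' sigma in
    fun A => tau A - meas_avg (N t) tau A
  else sigma.

Definition meas_pullback (n : nat) sigma : set T -> \bar R :=
  fun E => (n%:R^-1)%:E *
    \sum_(0 <= k < n) sigma (circle_pow n @` (E `&` circle_sector n k)).

(* Intended for C an arc: there the series converges absolutely when sigma is a
   charge of total mass 0, and all its terms are finite. *)
Definition Psi_meas (N : nat -> nat) (t : nat) sigma : set T -> \bar R :=
  fun C => \sum_(n <oo | n \in gen_monoid N t) meas_pullback n sigma C.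

End measures.

Section functions.
Variable R : realType.
Implicit Types u v f g h : R[i] -> R[i].

Definition disc : set R[i] := [set z | `|z| < 1].

Definition disc_analytic f := forall z, disc z -> derivable f z 1.

Definition disc_bounded f := exists B : R[i], forall z, disc z -> `|f z| <= B.

Definition disc_zero_free f := forall z, disc z -> f z != 0.

(* Functions on the disc are represented by functions on R[i] whose values
   outside the disc are irrelevant. *)
Definition nevanlinna f := exists g h,
  [/\ disc_analytic g /\ disc_bounded g, disc_analytic h /\ disc_bounded h,
      disc_zero_free h & forall z, disc z -> f z = g z / h z].

Definition nevanlinna_unit f := nevanlinna f /\
  exists g, nevanlinna g /\ forall z, disc z -> f z * g z = 1.

Definition nevanlinna1 f := nevanlinna_unit f /\ f 0 = 1.

Definition rotation_prod (n : nat) u : R[i] -> R[i] :=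
  fun z => \big[*%R/1]_(zeta \in [set zeta : R[i] | zeta ^+ n = 1]) u (zeta * z).

(* For u analytic and zero-free on the disc with u 0 = 1, such a v exists and
   its values on the disc are uniquely determined, so neither the default value
   nor the choice made by xget matters there. *)
Definition fun_avg (n : nat) u : R[i] -> R[i] :=
  xget (fun=> 1) [set v | [/\ disc_analytic v, v 0 = 1
    & forall z, disc z -> v z ^+ n = rotation_prod n u z]].

Fixpoint Omega_fun (N : nat -> nat) (t : nat) u : R[i] -> R[i] :=
  if t is t'.+1 then
    let v := Omega_fun N t' u in
    fun z => v z / fun_avg (N t) v z
  else u.

(* The product converges absolutely on the disc, so the order of the factors
   is immaterial. *)
Definition Psi_fun (N : nat -> nat) (t : nat) u : R[i] -> R[i] :=
  fun z => limn (fun k =>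
    \prod_(0 <= n < k | n \in gen_monoid N t) u (z ^+ n) : R[i]).

End functions.

(* Main.v *)
Require Import Defs.
From mathcomp Require Import all_boot all_order all_algebra.
From mathcomp Require Import complex finmap ring lra.
From mathcomp Require Import all_classical all_reals all_analysis.
From mathcomp Require Import measurable_realfun.

Set Implicit Arguments.
Unset Strict Implicit.

Import Order.TTheory GRing.Theory Num.Theory.
Import numFieldNormedType.Exports.

Local Open Scope classical_set_scope.
Local Open Scope ring_scope.

(* Put M = N_s, so that the generators of S' are coprime to M and S is the
   disjoint union of S' and M S.  An M_*-invariant sigma satisfies
   M^* sigma = e_M sigma, invariance passes to tau = Omega_{S'} sigma, and
   n^* M^* = (nM)^*.  Hence Psi_S (Omega_S sigma) is the sum over n in S of
   n^* tau - (nM)^* tau, which telescopes to the sum over S'; the boundary terms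
   vanish because |n^* tau (C)| = O(1/n) on arcs and the reciprocals of the
   elements of S are summable.

   The functional equation says likewise that u(z^M) is the root u^{e_M}.  It
   passes to v = Omega_{S'} u by uniqueness of analytic roots, and the product of
   v(z^n) / v(z^{nM}) over S telescopes.  Analytic roots of zero-free functions
   need not be constructed: if there is no root, [fun_avg] is the constant 1
   and dividing by it changes nothing. *)

(** * The monoid generated by the N_i *)

(** The bound O(1/n) rests on total mass 0: the n-th power maps a full sector onto the whole circle,
    so in n^* tau (C) only the sectors that C cuts properly can contribute. Sectors and arcs are
    therefore described by an angle in [0, 2 pi). This angle jumps at the point 1, and an arc whose
    angles do not form an interval is reached through its complement. Summability of the reciprocals
    comes from the telescoping identity itself, since the sum over S is at most the sum over S' plus
    1/M times the sum over S. The comparison is made between partial sums and products up to the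
    same k: those for S' and for S differ exactly by the multiples of M of S in [k, k * M), and this
    block disappears in the limit. On the side of measures, the [\bar R]-valued set functions are
    represented by real-valued finitely additive ones. Representation and invariance hold on
    measurable sets only, so arcs and the images of their sectors must be shown measurable. *)

Section generated_monoid.
Variable N : nat -> nat.

Lemma gen_monoid1 t : gen_monoid N t 1%N.
Proof. by move=> A [[]]. Qed.

Lemma gen_monoidM t m n :
  gen_monoid N t m -> gen_monoid N t n -> gen_monoid N t (m * n)%N.
Proof.
by move=> Sm Sn A A_; have [[_ +] _] := A_; apply; [exact: Sm|exact: Sn].
Qed.

Lemma gen_monoid_gen t i : (1 <= i <= t)%N -> gen_monoid N t (N i).
Proof. by move=> it A [_]; apply; exists i. Qed.

Lemma gen_monoid_ind t (P : nat -> Prop) :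
  P 1%N -> (forall m n, P m -> P n -> P (m * n)%N) ->
  (forall i, (1 <= i <= t)%N -> P (N i)) -> forall n, gen_monoid N t n -> P n.
Proof.
by move=> P1 PM PN n; apply; split=> // _ [i /= it <-]; exact: PN.
Qed.

Lemma gen_monoid0 n : gen_monoid N 0 n -> n = 1%N.
Proof.
elim/gen_monoid_ind => // [_ _ -> -> //|i].
by case/andP => i1 i0; have := leq_trans i1 i0.
Qed.

Lemma sub_gen_monoidS t n : gen_monoid N t n -> gen_monoid N t.+1 n.
Proof.
elim/gen_monoid_ind; first exact: gen_monoid1.
  exact: gen_monoidM.
by move=> i /andP[i1 it]; apply: gen_monoid_gen; rewrite i1 leqW.
Qed.

Lemma gen_monoidS_dvd t n : gen_monoid N t.+1 n ->
  gen_monoid N t n \/ exists2 m, gen_monoid N t.+1 m & n = (m * N t.+1)%N.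
Proof.
elim/gen_monoid_ind; first by left; exact: gen_monoid1.
- move=> a b [Sa|[a' Sa' ->]] [Sb|[b' Sb' ->]].
  + by left; exact: gen_monoidM.
  + right; exists (a * b')%N; last by rewrite mulnA.
    by apply: gen_monoidM => //; exact: sub_gen_monoidS.
  + right; exists (a' * b)%N; last by rewrite mulnAC.
    by apply: gen_monoidM => //; exact: sub_gen_monoidS.
  + right; exists (a' * b' * N t.+1)%N; last by rewrite mulnACA !mulnA.
    apply: gen_monoidM; first exact: gen_monoidM.
    by apply: gen_monoid_gen; rewrite leqnn.
- move=> i /andP[i1]; rewrite leq_eqVlt => /predU1P[->|it].
    by right; exists 1%N; [exact: gen_monoid1|rewrite mul1n].
  by left; apply: gen_monoid_gen; rewrite i1.
Qed.

Definition pairwise_coprime_gen t :=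
  (forall i, (1 <= i <= t)%N -> (2 <= N i)%N) /\
  (forall i j, (1 <= i <= t)%N -> (1 <= j <= t)%N -> i != j ->
    coprime (N i) (N j)).

Lemma pairwise_coprime_genW t :
  pairwise_coprime_gen t.+1 -> pairwise_coprime_gen t.
Proof.
have W i : (1 <= i <= t)%N -> (1 <= i <= t.+1)%N.
  by case/andP => -> /leqW ->.
by case=> N2 Nco; split=> [i /W/N2|i j /W it /W jt]; [|exact: Nco].
Qed.

Lemma gen_monoid_gt0 t n : pairwise_coprime_gen t ->
  gen_monoid N t n -> (0 < n)%N.
Proof.
move=> [N2 _]; elim/gen_monoid_ind => // [m n' m0 n0|i /N2/ltnW//].
by rewrite muln_gt0 m0.
Qed.

Section step.
Variable t : nat.
Context (Nt : pairwise_coprime_gen t.+1).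
Let M := N t.+1.
Let S := gen_monoid N t.+1.

Lemma last_gen_gt1 : (1 < M)%N.
Proof. by apply: (proj1 Nt); rewrite leqnn. Qed.

Lemma coprime_gen_monoid n : gen_monoid N t n -> coprime n M.
Proof.
elim/gen_monoid_ind => [|m n' mM nM|i /andP[i1 it]]; first exact: coprime1n.
  by rewrite coprimeMl mM.
by apply: (proj2 Nt); rewrite ?i1 ?leqnn ?(leqW it)// ltn_eqF.
Qed.

(** Coprimality enters here: an element of S' is coprime to M > 1, so M cannot divide it. Expressing
    S' inside S by a divisibility test is the form that [bigID] can split on. *)
Lemma mem_gen_monoid_prev n :
  (n \in gen_monoid N t) = (n \in S) && ~~ (M %| n)%N.
Proof.
apply/idP/andP => [|[]].
  rewrite !inE => Sn; split; first exact: sub_gen_monoidS.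
  apply/negP => Mn; have := coprime_gen_monoid Sn.
  rewrite /coprime gcdnC; move/gcdn_idPl : Mn => -> /eqP M1.
  by have := last_gen_gt1; rewrite M1.
rewrite !inE => /gen_monoidS_dvd[//|[m _ ->]].
by rewrite dvdn_mull.
Qed.

(** From right to left S is closed under multiplication by M. Conversely a multiple of M is not in
    S', so it has the form m * M with m in S, and M cancels. *)
Lemma mem_gen_monoid_mul n : (n * M \in S)%N = (n \in S).
Proof.
have M0 : (0 < M)%N := ltnW last_gen_gt1.
apply/idP/idP; rewrite !inE => SnM; last first.
  by apply: gen_monoidM => //; apply: gen_monoid_gen; rewrite leqnn.
have [SnM'|[m Sm /eqP]] := gen_monoidS_dvd SnM.
  have : (n * M)%N \in gen_monoid N t by rewrite inE.
  by rewrite mem_gen_monoid_prev dvdn_mull// andbF.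
by rewrite eqn_pmul2r// => /eqP ->.
Qed.

Section telescope.
Variables (T : Type) (idx : T) (op : Monoid.com_law idx) (F : nat -> T).

(** Raising k by one adds the block [k * M, k * M + M), whose only multiple of M is its first
    element. The law is arbitrary because the same identity serves sums of measures, sums of
    reciprocals and products of functions. *)
Lemma big_gen_monoid_mul k :
  \big[op/idx]_(0 <= n < k * M | (n \in S) && (M %| n)%N) F n =
  \big[op/idx]_(0 <= n < k | n \in S) F (n * M)%N.
Proof.
have M0 : (0 < M)%N := ltnW last_gen_gt1.
elim: k => [|k IH]; first by rewrite mul0n !big_geq.
rewrite mulSn [in RHS]big_mkcond big_nat_recr//= -big_mkcond/= -IH.
rewrite addnC (big_cat_nat (n := k * M))//= ?leq_addr//; congr (op _ _).
have big0 : \big[op/idx]_((k * M).+1 <= n < k * M + M |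
    (n \in S) && (M %| n)%N) F n = idx.
  rewrite big_nat_cond big1// => i /andP[/andP[ki ik] /andP[_ /dvdnP[q iq]]].
  move: ki ik; rewrite iq ltn_pmul2r// addnC -mulSn ltn_pmul2r// ltnS.
  by move=> kq; rewrite leqNgt kq.
rewrite big_ltn_cond ?dvdn_mull// ?andbT; last first.
  by rewrite -[ltnLHS]addn0 ltn_add2l.
by rewrite big0 Monoid.mulm1 mem_gen_monoid_mul.
Qed.

(* Both sides are [prod_(n in S, n < k) F n] times
   [prod_(n in S, n < k) F (n * M)] up to the boundary block [k, k * M). *)
Lemma big_gen_monoid_telescope k :
  op (\big[op/idx]_(0 <= n < k | n \in S) F n)
     (\big[op/idx]_(k <= n < k * M | (n \in S) && (M %| n)%N) F n) =
  op (\big[op/idx]_(0 <= n < k | n \in gen_monoid N t) F n)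
     (\big[op/idx]_(0 <= n < k | n \in S) F (n * M)%N).
Proof.
rewrite -big_gen_monoid_mul.
rewrite [X in _ = op _ X](big_cat_nat (n := k))//=; last first.
  by rewrite leq_pmulr// ltnW// last_gen_gt1.
rewrite Monoid.mulmA; congr (op _ _).
rewrite (bigID (fun n => (M %| n)%N)) /= Monoid.mulmC; congr (op _ _).
by apply: eq_bigl => n; rewrite mem_gen_monoid_prev.
Qed.

End telescope.

End step.

(** The bound is the Euler product of the 1 / (1 - 1 / N_i), each factor being at most 2. It is
    obtained by induction: dropping the boundary block from the telescoping identity gives A <= 2 ^+
    t + A / M. *)
Lemma sum_inv_gen_monoid_le (R : realFieldType) t k : pairwise_coprime_gen t ->
  \sum_(0 <= n < k | n \in gen_monoid N t) n%:R^-1 <= 2 ^+ t :> R.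
Proof.
elim: t => [_|t IH Nt].
  rewrite expr0 big_mkcond/=.
  apply: (@le_trans _ _ (\sum_(0 <= n < k) (n == 1)%:R)).
    apply: ler_sum => n _; case: ifPn; last by rewrite ler0n.
    by rewrite inE => /gen_monoid0 ->; rewrite invr1.
  rewrite -natr_sum lern1; case: k => [|[|k]]; first by rewrite big_geq.
    by rewrite big_nat1.
  rewrite big_ltn// big_ltn// big_nat_cond big1//.
  by move=> [|[]].
have IHt := IH (pairwise_coprime_genW Nt).
set A := (leLHS).
have M1 := last_gen_gt1 Nt.
have M2 : (2 : R) <= (N t.+1)%:R by rewrite ler_nat.
have tele := big_gen_monoid_telescope Nt +%R (fun n => n%:R^-1 : R) k.
have A0 : 0 <= A by apply: sumr_ge0 => n _; rewrite invr_ge0.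
have : A <= 2 ^+ t + A / 2.
  apply: (@le_trans _ _ (A + \sum_(k <= n < k * N t.+1 |
      (n \in gen_monoid N t.+1) && (N t.+1 %| n)%N) n%:R^-1)).
    by rewrite lerDl sumr_ge0// => n _; rewrite invr_ge0.
  rewrite [leLHS]tele lerD//.
  rewrite mulr_suml ler_sum// => n _.
  rewrite natrM invfM ler_wpM2l ?invr_ge0//.
  by rewrite lef_pV2// posrE// (lt_le_trans _ M2).
(* Adding the inequality A <= B + A / 2 to itself and cancelling one A leaves A <= 2 * B. *)
rewrite exprS; move: (2 ^+ t) => B AB.
have := lerD AB AB; rewrite addrACA -splitr lerD2r -mulr2n.
by rewrite mulr_natl.
Qed.

End generated_monoid.

(** * Complex functions on the disc *)

Section complex_norm.
Variable R : realType.
Notation C := R[i].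
Local Open Scope complex_scope.

Lemma normcRe (z : C) : `|z| = (complex.Re `|z|)%:C.
Proof. by rewrite RRe_real// normr_real. Qed.

(** In the partial order of [R[i]] a positive element has imaginary part 0, so every epsilon of the
    complex normed structure may be taken real. *)
Lemma complex_gt0P (e : C) : 0 < e -> exists2 r : R, 0 < r & e = r%:C.
Proof.
by case: e => a b; rewrite ltcE/= => /andP[/eqP -> a0]; exists a.
Qed.

Lemma cvg_complexP (T : Type) (F : set_system T) {FF : Filter F}
    (f : T -> C) (l : C) :
  f @ F --> l <->
  forall e : R, 0 < e -> \forall x \near F, `|l - f x| < e%:C.
Proof.
split=> [/cvgrPdist_lt fl e e0|fl].
  by apply: fl; rewrite ltcR.
by apply/cvgrPdist_lt => _ /complex_gt0P[e e0 ->]; exact: fl.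
Qed.

Lemma continuous_complex (T : topologicalType) (f g : T -> R) (x : T) :
  {for x, continuous f} -> {for x, continuous g} ->
  {for x, continuous (fun t => f t +i* g t)}.
Proof.
move=> fx gx; apply/cvg_complexP => e e0.
have e20 : 0 < e / 2 by rewrite divr_gt0.
move/cvgrPdist_lt : fx => /(_ _ e20) fx.
move/cvgrPdist_lt : gx => /(_ _ e20) gx.
near=> y.
rewrite [X in `|X|](_ : _ = (f x - f y)%:C + (g x - g y)%:C * 'i); last first.
  by apply/eqP; rewrite eq_complex/=; simpc.
rewrite (le_lt_trans (ler_normD _ _))// normrM.
have normR (r : R) : `|r%:C| = `|r|%:C.
  by rewrite normc_def/= expr0n/= addr0 sqrtr_sqr.
rewrite [ `|'i| ]normc_def/= expr0n/= expr1n add0r sqrtr1 mulr1 !normR.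
rewrite -rmorphD/= ltcR (splitr e) ltrD//.
- by near: y.
- by near: y.
Unshelve. all: by end_near. Qed.

Lemma finite_unity_roots n : (0 < n)%N ->
  finite_set [set z : C | z ^+ n = 1].
Proof.
move=> n0; have [rs /= Xn1] := closed_field_poly_normal ('X^n - 1 : {poly C}).
apply: (@sub_finite_set _ _ [set` rs]); last exact: finite_seq.
move=> z /= zn1.
have : root ('X^n - 1) z by rewrite rootE !hornerE/= zn1 subrr.
rewrite Xn1 rootZ ?root_prod_XsubC//.
by rewrite lead_coef_eq0 -size_poly_eq0 size_XnsubC.
Qed.

Lemma norm_unity_root n (z : C) : (0 < n)%N -> z ^+ n = 1 -> `|z| = 1.
Proof.
move=> n0 /(congr1 Num.norm); rewrite normrX normr1 => /eqP.
by rewrite pexpr_eq1// => /eqP.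
Qed.

End complex_norm.

Section disc.
Variable R : realType.
Notation C := R[i].
Local Open Scope complex_scope.
Implicit Types (u v w : C -> C) (z : C).

Lemma disc0 : disc (0 : C).
Proof. by rewrite /disc/= normr0. Qed.

Lemma disc_expr n z : (0 < n)%N -> disc z -> disc (z ^+ n).
Proof. by rewrite /disc/= normrX => n0 z1; rewrite exprn_ilt1// -lt0n. Qed.

Lemma disc_unity_rootM n (zeta : C) z : (0 < n)%N -> zeta ^+ n = 1 ->
  disc z -> disc (zeta * z).
Proof.
by move=> n0 zn; rewrite /disc/= normrM (norm_unity_root n0 zn) mul1r.
Qed.

Lemma nbhs_disc z : disc z -> \forall x \near z, disc x.
Proof.
move=> z1; have e0 : 0 < 1 - `|z| by rewrite subr_gt0.
near=> x; rewrite /disc/= -[x](subKr z) (le_lt_trans (ler_normB _ _))//.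
rewrite addrC -ltrBrDr; near: x.
by move/cvgrPdist_lt : (@cvg_id _ (nbhs z)); exact.
Unshelve. all: by end_near. Qed.

Lemma continuous_prodc (T : topologicalType) (I : eqType) (s : seq I)
    (F : I -> T -> C) x :
  (forall i, i \in s -> {for x, continuous (F i)}) ->
  {for x, continuous (fun y => \prod_(i <- s) F i y)}.
Proof.
elim: s => [_|i s IH Fs].
  rewrite (_ : (fun y => _) = cst 1); first exact: cvg_cst.
  by apply/funext => y; rewrite big_nil.
rewrite (_ : (fun y => _) = (fun y => F i y * \prod_(j <- s) F j y)).
  apply: cvgM; first by apply: Fs; rewrite inE eqxx.
  by apply: IH => j js; apply: Fs; rewrite inE js orbT.
by apply/funext => y; rewrite big_cons.
Qed.

Lemma disc_analytic_continuous u z : disc_analytic u -> disc z ->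
  {for z, continuous u}.
Proof. by move=> uA /uA/derivable1_diffP/differentiable_continuous. Qed.

Lemma disc_analytic_eq u v : (forall z, disc z -> u z = v z) ->
  disc_analytic u -> disc_analytic v.
Proof.
move=> uv uA z z1; apply: near_eq_derivable (uA z z1).
by near=> x; apply: uv; near: x; exact: nbhs_disc.
Unshelve. all: by end_near. Qed.

Lemma disc_analytic_div u v : disc_analytic u -> disc_analytic v ->
  disc_zero_free v -> disc_analytic (fun z => u z / v z).
Proof.
move=> uA vA v0 z z1; apply: (@derivableM _ _ u (fun z => (v z)^-1)).
  exact: uA.
by apply: derivableV; [exact: v0|exact: vA].
Qed.

Lemma derivable_exprn n z : derivable (fun x : C => x ^+ n) z 1.
Proof.
elim: n => [|n IH].
  by under eq_fun do rewrite expr0; exact: derivable_cst.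
rewrite (_ : (fun x => _) = (fun x => x) * (fun x => x ^+ n)).
  have di : derivable (fun x : C => x) z 1 by exact: derivable_id.
  exact: (derivableM di IH).
by apply/funext => x; rewrite exprS.
Qed.

Lemma disc_analytic_expr u n : (0 < n)%N -> disc_analytic u ->
  disc_analytic (fun z => u (z ^+ n)).
Proof.
move=> n0 uA z z1; apply/derivable1_diffP.
apply: (@differentiable_comp _ _ _ _ (fun z : C => z ^+ n) u).
  by apply/derivable1_diffP; exact: derivable_exprn.
by apply/derivable1_diffP; apply: uA; exact: disc_expr.
Qed.

(* On a segment from 0 to z the quotient of two roots is a continuous function
   with values in the finite set of n-th roots of unity. *)
Lemma disc_root_unique n v w : (0 < n)%N ->
  (forall z, disc z -> {for z, continuous v}) ->
  (forall z, disc z -> {for z, continuous w}) ->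
  disc_zero_free w -> v 0 = w 0 ->
  (forall z, disc z -> v z ^+ n = w z ^+ n) ->
  forall z, disc z -> v z = w z.
Proof.
move=> n0 vC wC w0 v0 vw z z1.
pose f (t : R) := v (t%:C * z) / w (t%:C * z).
have discz (t : R) : t \in `[0, 1] -> disc (t%:C * z).
  rewrite in_itv/= => /andP[t0 t1].
  rewrite /disc/= normrM; apply: le_lt_trans z1.
  by rewrite ger0_norm ?ler0c// ler_piMl// -[1]/(1%:C) lecR.
have fn t : t \in `[0, 1] -> f t ^+ n = 1.
  move=> t01; have d := discz _ t01.
  by rewrite expr_div_n vw// divff// expf_neq0// w0.
have fC : {within `[0, 1]%classic, continuous f}.
  apply: continuous_in_subspaceT => t /set_mem t01.
  have tz : {for t, continuous (fun t : R => t%:C * z)}.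
    apply: cvgM; last exact: cvg_cst.
    by apply: continuous_complex; [exact: cvg_id|exact: cvg_cst].
  apply: cvgM; first exact: (continuous_comp tz (vC _ (discz _ t01))).
  apply: cvgV; first exact/w0/discz.
  exact: (continuous_comp tz (wC _ (discz _ t01))).
have fcon : connected (f @` `[0, 1]%classic).
  by apply: connected_continuous_connected fC; exact: segment_connected.
have f0 : f 0 = 1 by rewrite /f mul0r v0 divff// w0//; exact: disc0.
(* Every set of n-th roots of unity is finite, hence closed. Thus {1} is both open and closed
   relative to the image of the segment. *)
have closedF (A : set C) : A `<=` [set x : C | x ^+ n = 1] -> closed A.
  have T1 : accessible_space C by exact/hausdorff_accessible/norm_hausdorff.
  move/accessible_finite_set_closed : T1 => clF An; apply: clF.
  exact: sub_finite_set An (finite_unity_roots R n0).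
have f01 : [set (1 : C)] = f @` `[0, 1]%classic.
  apply: fcon; first by exists 1.
  - exists (~` [set x : C | x ^+ n = 1 /\ x != 1]).
      by apply: closed_openC; apply: closedF => x [].
    apply/seteqP; split=> [_ ->|_ [[t t01 <-]]/=].
      split; last by case=> _ /eqP.
      by exists 0 => //=; rewrite in_itv/= lexx ler01.
    by move=> ft; apply: contrapT => /eqP ft1; apply: ft; split=> //; exact: fn.
  - exists [set 1]; first by apply: closedF => _ ->; exact: expr1n.
    apply/seteqP; split=> [_ ->|_ [_ ->]]//; split=> //.
    by exists 0 => //=; rewrite in_itv/= lexx ler01.
have : (f @` `[0, 1]%classic) (f 1) by exists 1 => //=; rewrite in_itv/= lexx ler01.
rewrite -f01 /= /f mul1r => /(congr1 ( *%R^~ (w z))).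
by rewrite mulfVK ?mul1r// w0.
Qed.

End disc.

(** * The functional equation *)

(** Bezout without subtraction: k inverts M modulo n, so on n-th roots of unity the k-th power
    inverts the M-th power. *)
Lemma coprime_inv_mod n M : (0 < M)%N -> coprime n M ->
  exists k j : nat, (k * M = j * n + 1)%N.
Proof.
move=> M0; rewrite coprime_sym => /eqP nM; case: (egcdnP n M0) => k j kM _.
by exists k, j; rewrite kM nM.
Qed.

Section rotation_prod.
Variable R : realType.
Notation C := R[i].
Implicit Types (u v w : C -> C) (z : C).

Lemma set_bij_unity_roots n M : (0 < M)%N -> coprime n M ->
  set_bij [set z : C | z ^+ n = 1] [set z : C | z ^+ n = 1]
    (fun z => z ^+ M).
Proof.
move=> M0 /(coprime_inv_mod M0)[k [j kj]].
have inv z : z ^+ n = 1 -> z ^+ (k * M) = z.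
  by move=> zn; rewrite kj exprD mulnC exprM zn expr1n mul1r expr1.
split=> [z /= zn|x y /set_mem/= xn /set_mem/= yn xy|z /= zn].
- by rewrite -exprM mulnC exprM zn expr1n.
- by rewrite -(inv _ xn) -(inv _ yn) mulnC !exprM xy.
- exists (z ^+ k); last by rewrite -exprM inv.
  by rewrite /= -exprM mulnC exprM zn expr1n.
Qed.

Lemma rotation_prodE n u z : (0 < n)%N ->
  rotation_prod n u z =
  \prod_(zeta <- fset_set [set zeta : C | zeta ^+ n = 1]) u (zeta * z).
Proof.
by move=> n0; rewrite /rotation_prod fsbig_finite//; exact: finite_unity_roots.
Qed.

Lemma mem_unity_roots n (zeta : C) : (0 < n)%N ->
  zeta \in fset_set [set zeta : C | zeta ^+ n = 1] -> zeta ^+ n = 1.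
Proof. by move=> n0; rewrite in_fset_set ?inE//; exact: finite_unity_roots. Qed.

Lemma rotation_prod_neq0 n u z : (0 < n)%N -> disc_zero_free u -> disc z ->
  rotation_prod n u z != 0.
Proof.
move=> n0 u0 z1; rewrite rotation_prodE// prodf_seq_neq0.
apply/allP => zeta /(mem_unity_roots n0) zn /=.
exact/u0/(disc_unity_rootM n0).
Qed.

Lemma rotation_prod0 n u : (0 < n)%N -> u 0 = 1 -> rotation_prod n u 0 = 1.
Proof.
by move=> n0 u0; rewrite rotation_prodE// big1// => zeta _; rewrite mulr0.
Qed.

Lemma rotation_prod_continuous n u : (0 < n)%N -> disc_analytic u ->
  forall z, disc z -> {for z, continuous (rotation_prod n u)}.
Proof.
move=> n0 uA z z1; rewrite (_ : rotation_prod n u = fun x =>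
  \prod_(zeta <- fset_set [set zeta : C | zeta ^+ n = 1]) u (zeta * x)); last first.
  by apply/funext => x; exact: rotation_prodE.
apply: continuous_prodc => zeta /(mem_unity_roots n0) zn.
have az : {for z, continuous (fun x : C => zeta * x)}.
  exact: mulrl_continuous.
apply: (@continuous_comp _ _ _ (fun x : C => zeta * x) u _ az).
apply: disc_analytic_continuous => //.
exact: (disc_unity_rootM n0).
Qed.

Definition mult_functional_eq M u := forall z, disc z ->
  u (z ^+ M) ^+ M = rotation_prod M u z.

(** The invariant carried through the successive quotients of [Omega_fun]. *)
Definition normalized u := [/\ disc_analytic u, disc_zero_free u & u 0 = 1].

Lemma nevanlinna1_normalized u : nevanlinna1 u -> normalized u.
Proof.
move=> [[[g [h [[gA _] [hA _] h0 ugh]]] [g' [_ ug']]] u0]; split; last exact: u0.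
  apply: (@disc_analytic_eq _ (fun z => g z / h z)); last exact: disc_analytic_div.
  by move=> z /ugh.
move=> z /ug' ug1; apply/eqP => uz0; move: ug1 => /eqP.
by rewrite uz0 mul0r eq_sym oner_eq0.
Qed.

(* Both sides have the same n-th power: by coprimality the n-th roots of unity
   are permuted by [zeta |-> zeta ^+ M], so the functional equation of [u] can be
   used in each factor. *)
Lemma root_functional_eq n M u w : (0 < n)%N -> (0 < M)%N -> coprime n M ->
  normalized u -> mult_functional_eq M u -> disc_analytic w -> w 0 = 1 ->
  (forall z, disc z -> w z ^+ n = rotation_prod n u z) ->
  mult_functional_eq M w.
Proof.
move=> n0 M0 nM [uA u0 u1] ueq wA w1 wn z z1; apply/esym; move: z z1.
have w0 : disc_zero_free w.
  move=> z z1; apply: contra_neq (rotation_prod_neq0 n0 u0 z1) => wz.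
  by rewrite -wn// wz expr0n gtn_eqF.
apply: (disc_root_unique n0).
- exact: rotation_prod_continuous.
- move=> z z1; have wM := disc_analytic_continuous (disc_analytic_expr M0 wA) z1.
  apply: (@continuous_comp _ _ _ _ (fun x : C => x ^+ M) _ wM).
  exact/differentiable_continuous/derivable1_diffP/derivable_exprn.
- by move=> z z1; rewrite expf_neq0// w0//; exact: disc_expr.
- by rewrite rotation_prod0// expr0n gtn_eqF// w1 expr1n.
move=> z z1; rewrite -exprM mulnC exprM wn; last exact: disc_expr.
rewrite /rotation_prod
  (@reindex_fsbig _ _ _ _ _ _ _ _ _ (@set_bij_unity_roots n M M0 nM)).
rewrite -/(rotation_prod M w z) rotation_prodE// -prodrXl.
rewrite fsbig_finite; last exact: finite_unity_roots.
rewrite -prodrXl.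
transitivity (\prod_(zeta <- fset_set [set zeta : C | zeta ^+ M = 1])
   \prod_(eta <- fset_set [set zeta : C | zeta ^+ n = 1]) u (eta * (zeta * z))).
  rewrite !big_seq; apply: eq_bigr => zeta /(mem_unity_roots M0) zM.
  by rewrite wn ?rotation_prodE//; exact: (disc_unity_rootM M0).
rewrite exchange_big/= [LHS]big_seq [RHS]big_seq.
apply: eq_bigr => eta /(mem_unity_roots n0) en.
rewrite -exprMn ueq ?rotation_prodE//; last exact: (disc_unity_rootM n0).
by apply: eq_bigr => zeta _; rewrite mulrCA.
Qed.

Lemma fun_avg_cases n u : fun_avg n u = (fun=> 1) \/
  [/\ disc_analytic (fun_avg n u), fun_avg n u 0 = 1
    & forall z, disc z -> fun_avg n u z ^+ n = rotation_prod n u z].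
Proof. by rewrite /fun_avg; case: xgetP => [w _ ww|_]; [right|left]. Qed.

Lemma div_fun_avg n M u : (0 < n)%N -> (0 < M)%N -> coprime n M ->
  normalized u -> mult_functional_eq M u ->
  normalized (fun z => u z / fun_avg n u z) /\
  mult_functional_eq M (fun z => u z / fun_avg n u z).
Proof.
move=> n0 M0 nM nu ueq.
have [->|[wA w1 wn]] := fun_avg_cases n u.
  by rewrite (_ : (fun z => _) = u)//; apply/funext => z; rewrite divr1.
have weq := root_functional_eq n0 M0 nM nu ueq wA w1 wn.
move: (fun_avg n u) => w in wA w1 wn weq *.
have [uA u0 u1] := nu.
have w0 : disc_zero_free w.
  move=> z z1; apply: contra_neq (rotation_prod_neq0 n0 u0 z1) => wz.
  by rewrite -wn// wz expr0n gtn_eqF.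
split.
  split; first exact: disc_analytic_div.
  - by move=> z z1; rewrite mulf_neq0 ?invr_neq0 ?u0 ?w0.
  - by rewrite u1 w1 divr1.
move=> z z1; rewrite expr_div_n ueq// weq// !rotation_prodE//.
by rewrite prodf_div.
Qed.

(** The functional equation exhibits a root, so [xget] does not fall back on its default; uniqueness
    of roots then identifies its choice. *)
Lemma fun_avg_functional_eq M u : (0 < M)%N ->
  normalized u -> mult_functional_eq M u ->
  forall z, disc z -> fun_avg M u z = u (z ^+ M).
Proof.
move=> M0 [uA u0 u1] ueq.
have : exists w, [/\ disc_analytic w, w 0 = 1
    & forall z, disc z -> w z ^+ M = rotation_prod M u z].
  exists (fun z => u (z ^+ M)); split; last exact: ueq.
    exact: disc_analytic_expr.
  by rewrite expr0n gtn_eqF.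
move=> /(@xgetPex _ (fun=> 1) [set w : C -> C | _]) []; rewrite -/(fun_avg M u).
move=> wA w1 wM; apply: (disc_root_unique M0).
- by move=> z; exact: disc_analytic_continuous.
- by move=> z; apply: disc_analytic_continuous; exact: disc_analytic_expr.
- by move=> z z1; rewrite u0//; exact: disc_expr.
- by rewrite w1 expr0n gtn_eqF.
- by move=> z z1; rewrite wM// ueq.
Qed.

Lemma Omega_fun_functional_eq (N : nat -> nat) M t u : (0 < M)%N ->
  (forall i, (1 <= i <= t)%N -> (0 < N i)%N /\ coprime (N i) M) ->
  normalized u -> mult_functional_eq M u ->
  normalized (Omega_fun N t u) /\ mult_functional_eq M (Omega_fun N t u).
Proof.
move=> M0; elim: t => //= t IH NM nu ueq.
have [|nv veq] := IH _ nu ueq.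
  by move=> i /andP[i1 it]; apply: NM; rewrite i1 leqW.
have [N0 NtM] := NM t.+1 (introT andP (conj (ltn0Sn t) (leqnn t.+1))).
exact: div_fun_avg.
Qed.

End rotation_prod.

(** * Telescoping products *)

Section infinite_products.
Variable R : realType.
Notation C := R[i].
Local Open Scope complex_scope.
Implicit Types (u v w : C -> C) (z : C).

(* No convergence is required: if one of the sequences diverges then so does
   the other and both limits are the same default value. *)
Lemma limn_mul_cvg1 (a b t : nat -> C) : (forall k, a k = b k * t k) ->
  (forall k, t k != 0) -> t @ \oo --> (1 : C) -> limn a = limn b.
Proof.
move=> abt t0 t1; rewrite /lim /lim_in; congr (get _).
apply/funext => l; apply/propext; split => [al|bl].
  have -> : b = (fun k => a k * (t k)^-1).
    by apply/funext => k; rewrite abt mulfK.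
  have tV : (fun k => (t k)^-1) @ \oo --> (1 : C)^-1.
    exact: (cvgV (oner_neq0 _) t1).
  by rewrite -[l]mulr1 -[X in _ * X]invr1; exact: (cvgM al tV).
have -> : a = (fun k => b k * t k) by apply/funext.
by rewrite -[l]mulr1; exact: (cvgM bl t1).
Qed.

Lemma derivable_lipschitz0 u : derivable u 0 1 ->
  exists K d : R, [/\ 0 < K, 0 < d &
    forall h, `|h| < d%:C -> `|u h - u 0| <= K%:C * `|h|].
Proof.
move=> /cvg_ex[/= l /cvgrPdist_lt /(_ 1 ltr01)].
rewrite near_withinE => /nbhs_ballP[_ /= /complex_gt0P[d d0 ->]] ball_l.
(* For 0 < |h| < d the difference quotient lies within 1 of the derivative l, whence the constant
   |l| + 1. *)
exists (complex.Re `|l| + 1), d; split=> //.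
  by rewrite ltr_pwDr// -lecR -normcRe; exact: normr_ge0.
move=> h hd; have [->|h0] := eqVneq h 0.
  by rewrite subrr !normr0 mulr0.
have /(_ _ h0) := ball_l h.
rewrite /ball/= sub0r normrN => /(_ hd).
rewrite addr0 -[h *: 1]/(h * 1) mulr1 -[h^-1 *: _]/(h^-1 * _) => lh.
rewrite -[X in `|X|](mulVKf h0) normrM mulrC ler_wpM2r//.
rewrite -[X in `|X|](subKr l) (le_trans (ler_normB _ _))//.
by rewrite rmorphD/= -normcRe lerD2l ltW.
Qed.

(** Induction through y Q - 1 = (y - 1) Q + (Q - 1). The sum being at most 1/2 keeps |Q| <= 2, which
    is the factor 2 of the conclusion. *)
Lemma prod_near1 (I : Type) (s : seq I) (P : pred I) (y : I -> C) (e : I -> R) :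
  (forall i, 0 <= e i) -> (forall i, P i -> `|y i - 1| <= (e i)%:C) ->
  \sum_(i <- s | P i) e i <= 2^-1 ->
  `|\prod_(i <- s | P i) y i - 1| <= (2 * \sum_(i <- s | P i) e i)%:C.
Proof.
move=> e0 ye; elim: s => [|i s IH].
  by rewrite !big_nil subrr normr0 mulr0.
rewrite !big_cons; case: ifPn => // Pi.
set Q := \prod_(_ <- _ | _) _; set S := \sum_(_ <- _ | _) _ => eS.
have S0 : 0 <= S by exact: sumr_ge0.
have {}IH : `|Q - 1| <= (2 * S)%:C.
  by apply: IH; apply: le_trans eS; rewrite lerDr.
have Q2 : `|Q| <= 2%:C.
  rewrite -[Q](subrK 1) (le_trans (ler_normD _ _))// normr1.
  apply: (le_trans (lerD IH (lexx 1))).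
  rewrite -[X in _ + X]/(1%:C) -rmorphD/= lecR.
  have : S <= 2^-1 by apply: le_trans eS; rewrite lerDr.
  by lra.
rewrite [X in `|X|](_ : _ = (y i - 1) * Q + (Q - 1)); last by ring.
rewrite (le_trans (ler_normD _ _))// mulrDr rmorphD/= lerD//.
by rewrite normrM mulrC rmorphM/= ler_pM// ye.
Qed.

Lemma sum_expr_le (r : R) k m : 0 <= r < 1 ->
  \sum_(k <= n < m) r ^+ n <= r ^+ k / (1 - r).
Proof.
move=> /andP[r0 r1]; have r10 : 0 < 1 - r by rewrite subr_gt0.
have [mk|km] := leqP m k.
  by rewrite big_geq// divr_ge0 ?exprn_ge0// ltW.
rewrite ler_pdivlMr// mulr_suml.
rewrite (eq_bigr (fun n => - r ^+ n.+1 - - r ^+ n)); last first.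
  by move=> n _; rewrite exprSr; ring.
by rewrite telescope_sumr ?(ltnW km)// opprK gerDr oppr_le0 exprn_ge0.
Qed.

(** Near 0 the function is Lipschitz, so |u(z^n) - 1| <= K |z|^n for n >= k and k large. The
    geometric tail from k on bounds the product whatever the upper end [b k] is. *)
Lemma cvg_prod_tail u z (P : pred nat) (b : nat -> nat) : disc_analytic u ->
  u 0 = 1 -> disc z ->
  (fun k => \prod_(k <= n < b k | P n) u (z ^+ n)) @ \oo --> (1 : C).
Proof.
move=> /(_ 0 (@disc0 R))/derivable_lipschitz0[K [d [K0 d0]]].
move=> + u0 z1; rewrite u0 => uK.
pose r := complex.Re `|z|.
have r0 : 0 <= r by rewrite -lecR -normcRe; exact: normr_ge0.
have r1 : r < 1 by rewrite -ltcR -normcRe; exact: z1.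
have r10 : 0 < 1 - r by rewrite subr_gt0.
have rn n : `|z ^+ n| = (r ^+ n)%:C by rewrite normrX normcRe rmorphXn.
apply/cvg_complexP => e e0.
(* A sum below c satisfies both demands of [prod_near1]: c <= 1/2 for its hypothesis, and 2 * c <= e
   for the estimate wanted. *)
pose c := Num.min 1 e / 2.
have c0 : 0 < c by rewrite divr_gt0// lt_min ltr01.
have c'0 : 0 < c * (1 - r) / K := divr_gt0 (mulr_gt0 c0 r10) K0.
have /cvgrPdist_lt r_cvg0 : (fun k => r ^+ k) @ \oo --> 0.
  by apply: cvg_expr; rewrite ger0_norm.
near=> k.
have rk (x : R) : `|0 - r ^+ k| < x -> r ^+ k < x.
  by rewrite sub0r normrN ger0_norm// exprn_ge0.
have rkd : r ^+ k < d by apply: rk; near: k; exact: r_cvg0.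
have rkc : r ^+ k < c * (1 - r) / K by apply: rk; near: k; exact: r_cvg0.
(* The condition k <= n is repeated in the predicate because [prod_near1] sees the predicate but not
   the range of the indices. *)
have sumc : \sum_(k <= n < b k | P n && (k <= n)%N) K * r ^+ n < c.
  apply: (@le_lt_trans _ _ (K * (r ^+ k / (1 - r)))); last first.
    by move: rkc; rewrite ltr_pdivlMr// mulrC mulrA ltr_pdivrMr.
  apply: (le_trans _ (ler_wpM2l (ltW K0) (@sum_expr_le r k (b k) _))); last first.
    by rewrite r0.
  rewrite mulr_sumr big_mkcond ler_sum// => n _; case: ifP => // _.
  by rewrite mulr_ge0 ?exprn_ge0// ltW.
rewrite distrC.
rewrite (_ : \prod_(k <= n < b k | P n) u (z ^+ n) =
  \prod_(k <= n < b k | P n && (k <= n)%N) u (z ^+ n)); last first.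
  rewrite big_nat_cond [RHS]big_nat_cond; apply: eq_bigl => n.
  by case: (k <= n)%N; rewrite ?andbT ?andbF.
apply: le_lt_trans.
  apply: (@prod_near1 _ _ _ _ (fun n => K * r ^+ n)).
  - by move=> n; rewrite mulr_ge0 ?exprn_ge0// ltW.
  - move=> n /andP[_ kn]; rewrite rmorphM/= -rn; apply: uK.
    by rewrite rn ltcR (le_lt_trans _ rkd)// ler_wiXn2l// ltW.
  - by apply: (le_trans (ltW sumc)); rewrite /c ler_piMl// ge_min lexx.
rewrite ltcR mulrC -ltr_pdivlMr//; apply: (lt_le_trans sumc).
by rewrite ler_pM2r// ge_min lexx orbT.
Unshelve. all: by end_near. Qed.

(** The partial product over S' is the one over S times the block of multiples of M in [k, k * M).
    Zero-freeness allows the cancellation and keeps the block invertible; [cvg_prod_tail] sends it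
    to 1. *)
Lemma Psi_fun_prev (N : nat -> nat) t u w : pairwise_coprime_gen N t.+1 ->
  normalized u -> (forall z, disc z -> w z = u (z ^+ N t.+1)) ->
  forall z, disc z ->
    Psi_fun N t u z = Psi_fun N t.+1 (fun z => u z / w z) z.
Proof.
move=> Nt [uA u_neq0 u0] wu z z1; rewrite /Psi_fun.
have u_n_neq0 n : (0 < n)%N -> u (z ^+ n) != 0.
  by move=> n0; rewrite u_neq0//; exact: disc_expr.
have M0 : (0 < N t.+1)%N := ltnW (last_gen_gt1 Nt).
have S0 n : n \in gen_monoid N t.+1 -> (0 < n)%N.
  by rewrite inE; exact: gen_monoid_gt0.
apply: (@limn_mul_cvg1 _ _ (fun k => \prod_(k <= n < k * N t.+1 |
   (n \in gen_monoid N t.+1) && (N t.+1 %| n)%N) u (z ^+ n))).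
- move=> k.
  rewrite [X in _ = X * _](eq_bigr (fun n => u (z ^+ n) / u (z ^+ (n * N t.+1)))); last first.
    by move=> n nS; have n0 := S0 _ nS; rewrite wu ?exprM//; apply: disc_expr.
  rewrite prodf_div mulrAC [X in _ = X / _](big_gen_monoid_telescope Nt).
  rewrite mulfK// prodf_seq_neq0; apply/allP => n _; apply/implyP => nS.
  have n0 := S0 _ nS.
  by rewrite u_n_neq0// muln_gt0 n0.
- move=> k; rewrite prodf_seq_neq0; apply/allP => n _.
  by apply/implyP => /andP[nS _]; exact/u_n_neq0/S0.
- exact: (@cvg_prod_tail u z _ (fun k => k * N t.+1)%N).
Qed.

End infinite_products.

(** * The angle of a point of the circle *)

Section angle.
Variable R : realType.
Notation C := R[i].
Local Notation T := (circle R).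
Local Open Scope complex_scope.
Implicit Types (z w : T) (a b : R).

Lemma circle_val_inj : injective (@circle_val R).
Proof. exact: val_inj. Qed.

Lemma cis_subproof a : `|cos a +i* sin a| == 1 :> C.
Proof. by rewrite normc_def/= cos2Dsin2 sqrtr1. Qed.

Definition cis a : T := Circle (cis_subproof a).

Lemma cisD a b : cis (a + b) = circle_mul (cis a) (cis b).
Proof.
apply: circle_val_inj; rewrite /= cosD sinD.
by apply/eqP; rewrite eq_complex/= eqxx/= addrC.
Qed.

Lemma cis0 : cis 0 = circle_one R.
Proof. by apply: circle_val_inj; rewrite /= cos0 sin0. Qed.

Lemma circle_pow_cis n a : circle_pow n (cis a) = cis (n%:R * a).
Proof.
apply: circle_val_inj; elim: n => [|n /= IH].
  by rewrite /= mul0r cos0 sin0 expr0.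
rewrite exprS IH -natr1 mulrDl mul1r addrC cosD sinD.
by apply/eqP; rewrite eq_complex/= eqxx/= addrC.
Qed.

Lemma cis2pi : cis (2 * pi) = circle_one R.
Proof. by apply: circle_val_inj; rewrite /= mulr_natl cos2pi sin2pi. Qed.

Lemma cisD2pin a k : cis (a + 2 * pi * k%:R) = cis a.
Proof.
apply: circle_val_inj; rewrite /= mulr_natr [2 * pi]mulr_natl.
by rewrite (periodicn (@cosD2pi R)) (periodicn (@sinD2pi R)).
Qed.

Lemma circle_Re2Im2 z :
  complex.Re (circle_val z) ^+ 2 + complex.Im (circle_val z) ^+ 2 = 1.
Proof.
have := circle_val1 z; rewrite normc_def => -[/(congr1 (fun x => x ^+ 2))].
by rewrite sqr_sqrtr ?addr_ge0 ?sqr_ge0// expr1n.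
Qed.

(** The branch with values in [0, 2 pi), for which every sector is a half-open interval of
    angles. *)
Definition arg z : R := if 0 <= complex.Im (circle_val z)
  then acos (complex.Re (circle_val z))
  else 2 * pi - acos (complex.Re (circle_val z)).

Lemma circle_Re_itv z : -1 <= complex.Re (circle_val z) <= 1.
Proof.
rewrite -ler_norml -(@ler_pXn2r _ 2)// ?nnegrE// expr1n real_normK ?num_real//.
by rewrite -(circle_Re2Im2 z) lerDl sqr_ge0.
Qed.

Lemma circle_Re_itvoo z : complex.Im (circle_val z) < 0 ->
  -1 < complex.Re (circle_val z) < 1.
Proof.
move=> z0.
rewrite -ltr_norml -(@ltr_pXn2r _ 2)// ?nnegrE// expr1n real_normK ?num_real//.
by rewrite -(circle_Re2Im2 z) ltrDl exprn_even_gt0//= lt_eqF.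
Qed.

Lemma arg_itv z : 0 <= arg z < 2 * pi.
Proof.
rewrite /arg; case: (leP 0 (complex.Im _)) => [_|z0].
  rewrite acos_ge0 ?circle_Re_itv//= (le_lt_trans (acos_lepi (circle_Re_itv z)))//.
  by rewrite ltr_pMl ?pi_gt0// ltr1n.
have /andP[Re1 Re2] := circle_Re_itvoo z0.
have := acos_lepi (circle_Re_itv z).
have := @acos_gt0 _ (complex.Re (circle_val z)); rewrite ltW// Re2 => /(_ isT).
have := @pi_gt0 R; lra.
Qed.

Lemma arg_ge0 z : 0 <= arg z. Proof. by have /andP[] := arg_itv z. Qed.

Lemma arg_lt2pi z : arg z < 2 * pi. Proof. by have /andP[] := arg_itv z. Qed.

Lemma argK : cancel arg cis.
Proof.
move=> z; apply: circle_val_inj; have zI := circle_Re_itv z.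
have sinE : sin (acos (complex.Re (circle_val z))) = `|complex.Im (circle_val z)|.
  by rewrite sin_acos// -(circle_Re2Im2 z) addrAC subrr add0r sqrtr_sqr.
have cosE : cos (acos (complex.Re (circle_val z))) = complex.Re (circle_val z).
  by rewrite acosK// in_itv.
apply/eqP; rewrite eq_complex/= /arg; case: (leP 0 (complex.Im _)) => z0.
  by rewrite cosE sinE ger0_norm// !eqxx.
rewrite addrC mulr_natl cosD2pi sinD2pi cosN sinN cosE sinE ltr0_norm//.
by rewrite opprK !eqxx.
Qed.

Lemma cisK a : 0 <= a < 2 * pi -> arg (cis a) = a.
Proof.
move=> /andP[a0 a2]; rewrite /arg/=; have [api|pia] := leP a pi.
  by rewrite sin_ge0_pi ?a0// cosK// in_itv/= a0.
have : 0 < sin (a - pi) by rewrite sin_gt0_pi// subr_gt0 pia/=; lra.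
rewrite -oppr_lt0 -sinDpi subrK => sa0; rewrite leNgt sa0/=.
rewrite -cosN -(@cosD2pi R) cosK; first by rewrite -mulr_natl; lra.
by rewrite in_itv/= -mulr_natl; apply/andP; split; lra.
Qed.

Lemma circle_pow_arg n z : circle_pow n z = cis (n%:R * arg z).
Proof. by rewrite -{1}(argK z) circle_pow_cis. Qed.

Lemma circle_mul_arg z w : circle_mul z w = cis (arg z + arg w).
Proof. by rewrite -{1}(argK z) -{1}(argK w) cisD. Qed.

Lemma continuous_cis : continuous (cis : R -> T).
Proof.
apply: continuous_comp_initial => a.
by apply: continuous_complex; [exact: continuous_cos|exact: continuous_sin].
Qed.

(** The image in the complex plane is compact, hence closed, and the circle carries the initial
    topology of [circle_val]. *)
Lemma closed_cis_itv a b : closed (cis @` `[a, b]%classic).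
Proof.
pose E : set C := (fun x => circle_val (cis x)) @` `[a, b]%classic.
have -> : cis @` `[a, b]%classic = @circle_val R @^-1` E.
  apply/seteqP; split=> [_ [x xab <-]|z [x xab xz]].
    by exists x.
  by exists x => //; exact: circle_val_inj.
have circC : continuous (@circle_val R) by exact: initial_continuous.
apply: closed_comp; first by move=> z _; exact: circC.
apply: compact_closed; first exact: norm_hausdorff.
apply: continuous_compact; last exact: segment_compact.
apply: continuous_subspaceT => x.
exact: (continuous_comp (@continuous_cis x) (@circC _)).
Qed.

(** At the point 1 the angle jumps, but it takes the lower value 0 there: it is lower
    semicontinuous, which is enough for Borel measurability. *)
Lemma arg_le_closed a : closed [set z | arg z <= a].
Proof.
have [a2|a2] := leP (2 * pi) a.
  rewrite (_ : [set z | _] = setT); first exact: closedT.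
  by apply/seteqP; split=> // z _ /=; rewrite (le_trans _ a2)// ltW// arg_lt2pi.
rewrite (_ : [set z | _] = cis @` `[0, a]%classic); first exact: closed_cis_itv.
apply/seteqP; split=> [z /= za|_ [x /=+ <-]].
  by exists (arg z); [rewrite /= in_itv/= arg_ge0|exact: argK].
by rewrite in_itv/= => /andP[x0 xa]; rewrite cisK// x0 (le_lt_trans xa).
Qed.

Lemma measurable_circle_open (A : set T) : open A -> measurable A.
Proof. by move=> oA; exact: sub_sigma_algebra. Qed.

Lemma measurable_arg : measurable_fun setT arg.
Proof.
apply: (measurability _ (RGenOInfty.measurableE R)).
move=> _ [_ [x ->] <-]; rewrite setTI.
rewrite (_ : _ @^-1` _ = ~` [set z | arg z <= x]).
  by apply: measurable_circle_open; apply: closed_openC; exact: arg_le_closed.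
apply/seteqP; split=> z /=; rewrite in_itv/= andbT => zx.
  by apply/negP; rewrite -ltNge.
by rewrite ltNge; apply/negP.
Qed.

Lemma measurable_cis : measurable_fun setT (cis : R -> T).
Proof.
apply: (@measurability _ _ _ _ _ _ (@open T)) => // _ [A oA <-].
rewrite setTI; apply: open_measurable.
by move/continuousP : continuous_cis; exact.
Qed.

Lemma measurable_arg_interval (I : set R) : is_interval I ->
  measurable (arg @^-1` I).
Proof.
move=> /is_interval_measurable mI; rewrite -[_ @^-1` _]setTI.
exact: measurable_arg.
Qed.

(** Powers, rotations and the inverse branches of powers all have this form, so their measurability
    is settled at once. *)
Lemma measurable_affine_arg (c b : R) :
  measurable_fun setT (fun z : T => cis (c * arg z + b)).
Proof.
apply: (measurableT_comp measurable_cis).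
apply: measurable_funD => //; apply: measurable_funM => //.
exact: measurable_arg.
Qed.

Lemma measurable_circle_pow n : measurable_fun setT (@circle_pow R n).
Proof.
rewrite (_ : circle_pow n = fun z => cis (n%:R * arg z + 0)).
  exact: measurable_affine_arg.
by apply/funext => z; rewrite circle_pow_arg addr0.
Qed.

Lemma measurable_circle_mul z : measurable_fun setT (circle_mul z).
Proof.
rewrite (_ : circle_mul z = fun w => cis (1 * arg w + arg z)).
  exact: measurable_affine_arg.
by apply/funext => w; rewrite circle_mul_arg mul1r addrC.
Qed.

End angle.

(** * Sectors *)

Section sectors.
Variable R : realType.
Local Notation T := (circle R).
Implicit Types (z w : T) (n k : nat).

(** The angle in full turns: sector k of n becomes k <= n t < k + 1, and on it the n-th power acts
    as t |-> n t - k. *)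
Definition turn z : R := arg z / (2 * pi).

Lemma pi2_gt0 : 0 < 2 * pi :> R.
Proof. by rewrite mulr_gt0// pi_gt0. Qed.

Lemma turn_itv z : 0 <= turn z < 1.
Proof.
rewrite /turn divr_ge0 ?arg_ge0 ?(ltW pi2_gt0)//=.
by rewrite ltr_pdivrMr ?pi2_gt0// mul1r arg_lt2pi.
Qed.

Lemma arg_turn z : arg z = 2 * pi * turn z.
Proof. by rewrite /turn mulrC divfK// gt_eqF// pi2_gt0. Qed.

Lemma turnK z : cis (2 * pi * turn z) = z.
Proof. by rewrite -arg_turn argK. Qed.

Lemma turn_inj : injective turn.
Proof. by move=> z w zw; rewrite -(turnK z) zw turnK. Qed.

Lemma cisK_turn (x : R) : 0 <= x < 1 -> turn (cis (2 * pi * x)) = x.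
Proof.
move=> /andP[x0 x1]; rewrite /turn cisK.
  by rewrite mulrC mulKf// gt_eqF// pi2_gt0.
by rewrite mulr_ge0 ?(ltW pi2_gt0)//= gtr_pMr// pi2_gt0.
Qed.

(** The angle in the definition of a sector is an arbitrary real, but k < n confines it to [0, 2
    pi), where it must be [arg z]. *)
Lemma circle_sectorP n k z : (k < n)%N ->
  circle_sector n k z <-> k%:R <= n%:R * turn z < k.+1%:R.
Proof.
move=> kn; have n0 : 0 < n%:R :> R by rewrite ltr0n (leq_trans _ kn).
have E (x : R) : (2 * pi * k%:R / n%:R <= 2 * pi * x) = (k%:R <= n%:R * x).
  by rewrite -[_ * _ / _]mulrA ler_pM2l ?pi2_gt0// ler_pdivrMr// mulrC.
have E' (x : R) : (2 * pi * x < 2 * pi * k.+1%:R / n%:R) = (n%:R * x < k.+1%:R).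
  by rewrite -[_ * _ / _]mulrA ltr_pM2l ?pi2_gt0// ltr_pdivlMr// mulrC.
split=> [[theta [t1 t2 zt]]|/andP[z1 z2]]; last first.
  by exists (arg z); rewrite arg_turn E E'; split=> //; rewrite -{1}(turnK z).
have -> : z = cis theta by exact: circle_val_inj.
rewrite -E -E' -arg_turn cisK ?t1// (lt_le_trans t2).
  by rewrite andbT (le_trans _ t1)// !mulr_ge0 ?invr_ge0 ?pi_ge0.
by rewrite ler_pdivrMr// ler_pM2l ?pi2_gt0// ler_nat.
Qed.

Lemma measurable_circle_sector n k : (k < n)%N ->
  measurable (@circle_sector R n k).
Proof.
move=> kn; rewrite (_ : circle_sector n k =
    @arg R @^-1` [set x | k%:R <= n%:R * (x / (2 * pi)) < k.+1%:R]).
  apply: measurable_arg_interval => x y /= /andP[x1 x2] /andP[y1 y2] t.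
  move=> /andP[xt ty]; have n0 : 0 <= n%:R :> R by [].
  have mono (a b : R) : a <= b -> n%:R * (a / (2 * pi)) <= n%:R * (b / (2 * pi)).
    by move=> ab; rewrite ler_wpM2l// ler_wpM2r// invr_ge0 ltW// pi2_gt0.
  by rewrite (le_trans x1 (mono _ _ xt)) (le_lt_trans (mono _ _ ty) y2).
apply/seteqP; split=> z; first by move/(circle_sectorP _ kn).
by move=> zk; apply/(circle_sectorP _ kn).
Qed.

Lemma circle_sector_cover n z : (0 < n)%N ->
  exists2 k, (k < n)%N & circle_sector n k z.
Proof.
move=> n0; have /andP[z0 z1] := turn_itv z.
have nz0 : 0 <= n%:R * turn z by rewrite mulr_ge0.
have /andP[k1 k2] := truncn_itv nz0.
have kn : (Num.truncn (n%:R * turn z) < n)%N.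
  by rewrite -(ltr_nat R) (le_lt_trans k1)// gtr_pMr// ltr0n.
exists (Num.truncn (n%:R * turn z)) => //; apply/circle_sectorP => //.
by rewrite k1.
Qed.

Lemma circle_sector_uniq n k l z : (k < n)%N -> (l < n)%N ->
  circle_sector n k z -> circle_sector n l z -> k = l.
Proof.
move=> kn ln /(circle_sectorP _ kn)/andP[k1 k2] /(circle_sectorP _ ln)/andP[l1 l2].
have := le_lt_trans k1 l2; have := le_lt_trans l1 k2; rewrite !ltr_nat => lk kl.
by apply/eqP; rewrite eqn_leq -ltnS kl -ltnS lk.
Qed.

Lemma turn_circle_pow n k z : (k < n)%N -> circle_sector n k z ->
  turn (circle_pow n z) = n%:R * turn z - k%:R.
Proof.
move=> kn /(circle_sectorP _ kn)/andP[z1 z2]; rewrite circle_pow_arg.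
have -> : n%:R * arg z = 2 * pi * (n%:R * turn z - k%:R) + 2 * pi * k%:R.
  by rewrite arg_turn; ring.
rewrite cisD2pin cisK_turn// subr_ge0 z1/= ltrBlDl.
by rewrite natr1.
Qed.

Lemma circle_pow_sector_inj n k z w : (k < n)%N ->
  circle_sector n k z -> circle_sector n k w ->
  circle_pow n z = circle_pow n w -> z = w.
Proof.
move=> kn kz kw /(congr1 turn); rewrite !(turn_circle_pow kn)// => /addIr.
have n0 : n%:R != 0 :> R by rewrite pnatr_eq0 -lt0n (leq_trans _ kn).
by move=> /(mulfI n0)/turn_inj.
Qed.

(** The inverse branch of the n-th power on sector k. It turns the forward images in the pull-back
    into preimages under a measurable map. *)
Definition sector_section n k w : T :=
  cis (2 * pi * ((turn w + k%:R) / n%:R)).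

Lemma circle_pow_section n k w : (0 < n)%N ->
  circle_pow n (sector_section n k w) = w.
Proof.
move=> n0; rewrite circle_pow_cis.
have n0' : n%:R != 0 :> R by rewrite pnatr_eq0 -lt0n.
rewrite [n%:R * _](_ : _ = 2 * pi * turn w + 2 * pi * k%:R); last first.
  by field.
by rewrite cisD2pin turnK.
Qed.

Lemma sector_sectionP n k w : (k < n)%N ->
  circle_sector n k (sector_section n k w).
Proof.
move=> kn; apply/(circle_sectorP _ kn).
have n0 : 0 < n%:R :> R by rewrite ltr0n (leq_trans _ kn).
have /andP[w0 w1] := turn_itv w.
rewrite cisK_turn; first by rewrite mulrC divfK ?gt_eqF// lerDr w0 -natr1 addrC ltrD2l.
rewrite divr_ge0 ?addr_ge0//= ?(ltW n0)// ltr_pdivrMr// mul1r.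
rewrite (@lt_le_trans _ _ (1 + k%:R))// ?ltrD2r//.
by rewrite addrC natr1 ler_nat.
Qed.

Lemma sector_image n k (E : set T) : (k < n)%N ->
  circle_pow n @` (E `&` circle_sector n k) =
  sector_section n k @^-1` (E `&` circle_sector n k).
Proof.
move=> kn; have n0 : (0 < n)%N by rewrite (leq_trans _ kn).
apply/seteqP; split=> [_ [z [Ez zk] <-]|w [Ew wk]].
  suff zE : sector_section n k (circle_pow n z) = z by rewrite /preimage/= zE.
  apply: (circle_pow_sector_inj kn) => //; first exact: sector_sectionP.
  by rewrite circle_pow_section.
by exists (sector_section n k w) => //; exact: circle_pow_section.
Qed.

Lemma measurable_sector_image n k (E : set T) : (k < n)%N -> measurable E ->
  measurable (circle_pow n @` (E `&` circle_sector n k)).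
Proof.
move=> kn mE; rewrite sector_image// -[_ @^-1` _]setTI.
rewrite (_ : sector_section n k =
    fun w => cis (n%:R^-1 * arg w + 2 * pi * (k%:R / n%:R))).
  apply: measurable_affine_arg => //.
  by apply: measurableI => //; exact: measurable_circle_sector.
apply/funext => w; rewrite /sector_section; congr cis.
have n0 : n%:R != 0 :> R by rewrite pnatr_eq0 -lt0n (leq_trans _ kn).
by rewrite arg_turn; field.
Qed.

Lemma sector_image_full n k (E : set T) : (k < n)%N ->
  circle_sector n k `<=` E -> circle_pow n @` (E `&` circle_sector n k) = setT.
Proof.
move=> kn kE; rewrite sector_image//; apply/seteqP; split=> // w _.
by split; [apply: kE|]; exact: sector_sectionP.
Qed.

Lemma circle_powM n l z : circle_pow l (circle_pow n z) = circle_pow (n * l) z.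
Proof. by apply: circle_val_inj; rewrite /= exprM. Qed.

(** Sector k of n splits into l sectors of n * l; the j-th of them has index k * l + j and is what
    the n-th power sends to sector j of l. Summed over k and j this yields n^* l^* = (n l)^*. *)
Lemma sector_image_mul n l k j (E : set T) : (k < n)%N -> (j < l)%N ->
  circle_pow l @` (circle_pow n @` (E `&` circle_sector n k) `&`
    circle_sector l j) =
  circle_pow (n * l) @` (E `&` circle_sector (n * l) (k * l + j)).
Proof.
move=> kn jl.
have kjnl : (k * l + j < n * l)%N.
  rewrite (@leq_trans (k.+1 * l))//; first by rewrite mulSn addnC ltn_add2r.
  by rewrite leq_pmul2r// (leq_trans _ jl).
have l0 : 0 < l%:R :> R by rewrite ltr0n (leq_trans _ jl).
have secE z : circle_sector n k z ->
    circle_sector l j (circle_pow n z) <-> circle_sector (n * l) (k * l + j) z.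
  move=> zk.
  apply: (iff_trans (circle_sectorP _ jl)).
  apply: iff_sym; apply: (iff_trans (circle_sectorP _ kjnl)).
  rewrite (turn_circle_pow kn zk) -addnS !natrD !natrM.
  have -> : l%:R * (n%:R * turn z - k%:R) = n%:R * l%:R * turn z - k%:R * l%:R.
    by ring.
  by rewrite lerBrDl ltrBlDl.
have sec_sub z : circle_sector (n * l) (k * l + j) z -> circle_sector n k z.
  move=> /(circle_sectorP _ kjnl)/andP[z1 z2]; apply/(circle_sectorP _ kn).
  rewrite -(ler_pM2r l0) -(ltr_pM2r l0) [n%:R * _ * _]mulrAC -!natrM.
  rewrite (le_trans _ z1) ?ler_nat ?leq_addr//= (lt_le_trans z2)// ler_nat.
  by rewrite mulSn addnC ltn_add2r.
apply/seteqP; split=> [_ [_ [[z [Ez zk] <-] zj] <-]|_ [z [Ez zkj] <-]].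
  by rewrite circle_powM; exists z => //; split=> //; apply/secE.
rewrite -circle_powM; exists (circle_pow n z) => //.
have zk := sec_sub _ zkj; split; first by exists z.
exact/secE.
Qed.

End sectors.

(** * Arcs *)

Section contents.
Variable R : realType.
Local Notation T := (circle R).
Implicit Types (m : set T -> R) (A E : set T) (z w : T).

(** Real values let sums and differences be rearranged as in a ring, and the class is stable under
    subtracting an average over rotations. *)
Definition bounded_content m := [/\ m setT = 0,
  forall A E, measurable A -> measurable E -> A `&` E = set0 ->
    m (A `|` E) = m A + m E
  & exists B, forall A, measurable A -> `|m A| <= B].

Lemma bounded_content0 m : bounded_content m -> m set0 = 0.
Proof.
move=> [_ mU _]; have := mU set0 set0 measurable0 measurable0 (setI0 _).
by rewrite setU0 => /eqP; rewrite addrC -subr_eq subrr eq_sym => /eqP.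
Qed.

Lemma bounded_content_bigU m (I : choiceType) (s : seq I) (F : I -> set T) :
  bounded_content m -> uniq s -> (forall i, i \in s -> measurable (F i)) ->
  (forall i j, i \in s -> j \in s -> F i `&` F j !=set0 -> i = j) ->
  m (\bigcup_(i in [set` s]) F i) = \sum_(i <- s) m (F i).
Proof.
move=> mb; have [_ mU _] := mb; rewrite bigcup_seq.
elim: s => [_ _ _|i s IH /= /andP[i_s us] Fm Fd].
  by rewrite !big_nil; exact: bounded_content0.
rewrite !big_cons mU.
- rewrite IH// => [j js|j k js ks]; first by apply: Fm; rewrite inE js orbT.
  by apply: Fd; rewrite inE (js, ks) orbT.
- by apply: Fm; rewrite inE eqxx.
- rewrite -bigcup_seq; apply: fin_bigcup_measurable => //.
  by move=> j /= js; apply: Fm; rewrite inE js orbT.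
- rewrite -bigcup_seq; apply/seteqP; split=> // x [Fix [j /= js Fjx]].
  have ij : i = j.
    by apply: Fd; rewrite ?inE ?eqxx ?js ?orbT//; exists x.
  by move: i_s; rewrite ij js.
Qed.

Definition real_pullback n m E : R :=
  n%:R^-1 * \sum_(0 <= k < n) m (circle_pow n @` (E `&` circle_sector n k)).

Lemma mem_index_iota0 n k : (k \in index_iota 0 n) = (k < n)%N.
Proof. by rewrite mem_index_iota. Qed.

Lemma eq_real_pullback n m m' E : measurable E ->
  (forall A, measurable A -> m A = m' A) ->
  real_pullback n m E = real_pullback n m' E.
Proof.
move=> mE mm'; rewrite /real_pullback; congr (_ * _).
rewrite !big_seq; apply: eq_bigr => k; rewrite mem_index_iota0 => kn.
by apply: mm'; exact: measurable_sector_image.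
Qed.

Lemma real_pullbackB n m m' E :
  real_pullback n (fun A => m A - m' A) E =
  real_pullback n m E - real_pullback n m' E.
Proof. by rewrite /real_pullback big_split/= sumrN mulrBr. Qed.

(** The power map is injective on a single sector, so disjoint sets have disjoint images there. *)
Lemma real_pullbackU n m A E : bounded_content m ->
  measurable A -> measurable E -> A `&` E = set0 ->
  real_pullback n m (A `|` E) = real_pullback n m A + real_pullback n m E.
Proof.
move=> [_ mU _] mA mE AE; rewrite /real_pullback -mulrDr -big_split/=.
congr (_ * _); rewrite !big_seq; apply: eq_bigr => k.
rewrite mem_index_iota0 => kn.
rewrite setIUl image_setU mU//; try exact: measurable_sector_image.
apply/seteqP; split=> // _ [[x [Ax xk] <-] [y [Ey yk] xy]].
have yx := circle_pow_sector_inj kn yk xk xy.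
have : (A `&` E) x by split=> //; rewrite -yx.
by rewrite AE.
Qed.

Lemma real_pullbackT n m : bounded_content m -> real_pullback n m setT = 0.
Proof.
move=> [mT _ _]; rewrite /real_pullback big_seq big1 ?mulr0// => k.
by rewrite mem_index_iota0 => kn; rewrite sector_image_full.
Qed.

Lemma real_pullbackM n l m E : (0 < n)%N -> (0 < l)%N ->
  real_pullback n (real_pullback l m) E = real_pullback (n * l) m E.
Proof.
move=> n0 l0; rewrite /real_pullback -mulr_sumr mulrA natrM invfM; congr (_ * _).
rewrite big_nat_mul big_mkord; rewrite big_mkord.
apply: eq_bigr => k _.
rewrite mulSnr -{1}[(k * l)%N]add0n big_addn addKn !big_mkord.
by apply: eq_bigr => j _; rewrite sector_image_mul// addnC.
Qed.

(* The n-th power maps each sector onto the whole circle, of mass 0, so only the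
   sector containing the end point of the segment contributes. *)
Lemma initial_segment_bound n m E B : (0 < n)%N -> bounded_content m ->
  (forall A, measurable A -> `|m A| <= B) -> measurable E ->
  (forall z w, E z -> arg w <= arg z -> E w) ->
  `|real_pullback n m E| <= B / n%:R.
Proof.
move=> n0 mb mB mE Edown; have [mT mU _] := mb.
have nV0 : 0 <= n%:R^-1 :> R by rewrite invr_ge0.
rewrite /real_pullback normrM (ger0_norm nV0) mulrC ler_wpM2r//.
have B0 : 0 <= B by apply: le_trans (mB _ measurableT).
pose img k := circle_pow n @` (E `&` circle_sector n k).
have sector_le k l z w : (k < l)%N -> (l < n)%N ->
    circle_sector n k z -> circle_sector n l w -> arg z <= arg w.
  move=> kl ln /(circle_sectorP _ (ltn_trans kl ln))/andP[_ z2].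
  move=> /(circle_sectorP _ ln)/andP[w1 _].
  have n0' : 0 < n%:R :> R by rewrite ltr0n.
  rewrite !arg_turn (ler_pM2l (pi2_gt0 R)) -(ler_pM2l n0').
  by rewrite (le_trans (ltW z2))// (le_trans _ w1)// ler_nat.
have img0 k : (k < n)%N -> (forall z, circle_sector n k z -> E z) \/
    (forall z, circle_sector n k z -> ~ E z) -> m (img k) = 0.
  move=> kn [kE|kE]; first by rewrite /img sector_image_full.
  rewrite /img (_ : _ `&` _ = set0) ?image_set0 ?bounded_content0//.
  by apply/seteqP; split=> // z [Ez /kE].
have [[k [kn [[z [zk Ez]] [w [wk Ew]]]]]|none] := pselect (exists k, (k < n)%N /\
    ((exists z, circle_sector n k z /\ E z) /\
     (exists w, circle_sector n k w /\ ~ E w))).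
  rewrite (bigD1_seq k) ?mem_index_iota0 ?iota_uniq//= big_seq_cond.
  rewrite big1 ?addr0; first by apply: mB; exact: measurable_sector_image.
  move=> l /andP[]; rewrite mem_index_iota0 => ln lk; apply: img0 => //.
  move: lk; rewrite neq_ltn => /orP[lk|kl].
    by left => y yl; apply: Edown Ez _; exact: (sector_le l k).
  by right => y yl Ey; apply: Ew; apply: Edown Ey _; exact: (sector_le k l).
rewrite big_seq big1 ?normr0// => k; rewrite mem_index_iota0 => kn.
apply: img0 => //; apply: contrapT => /not_orP[/existsNP[w]].
move=> /not_implyP[wk Ew] /existsNP[z /not_implyP[zk /contrapT Ez]].
by apply: none; exists k; split=> //; split; [exists z|exists w].
Qed.

Lemma measurable_initial_segment E :
  (forall z w, E z -> arg w <= arg z -> E w) -> measurable E.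
Proof.
move=> Edown; rewrite (_ : E = @arg R @^-1` [set x | exists2 z, E z & x <= arg z]).
  apply: measurable_arg_interval => x y /= [z Ez xz] [w Ew yw] t /andP[_ ty].
  by exists w => //; exact: le_trans yw.
apply/seteqP; split=> [z Ez|z [w Ew zw]]; first by exists z.
exact: Edown zw.
Qed.

(** An interval of angles. An arc passing through the jump of [arg] at 1 may fail to be one, but
    then its complement is. *)
Definition arg_convex E := forall x y p, E x -> E y ->
  arg x <= arg p -> arg p <= arg y -> E p.

(** Such a set is a difference of initial segments: [D1] is everything up to a point of E, and
    convexity makes the remainder [D0] an initial segment as well. Each costs at most B / n, whence
    the constant B + B. *)
Lemma arg_convex_bound m E : bounded_content m -> arg_convex E ->
  measurable E /\ exists K, forall n, (0 < n)%N ->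
    `|real_pullback n m E| <= K / n%:R.
Proof.
move=> mb Econv; have [_ _ [B mB]] := mb.
pose D1 := [set z | exists2 y, E y & arg z <= arg y].
pose D0 := D1 `\` E.
have D1down z w : D1 z -> arg w <= arg z -> D1 w.
  by move=> [y Ey zy] wz; exists y => //; exact: le_trans zy.
have D0down z w : D0 z -> arg w <= arg z -> D0 w.
  move=> [D1z Ez] wz; split; first exact: D1down D1z wz.
  by case: D1z => y Ey zy Ew; apply: Ez; exact: (Econv w y).
have mD1 := measurable_initial_segment D1down.
have mD0 := measurable_initial_segment D0down.
have ED : E = D1 `\` D0.
  apply/seteqP; split=> [z Ez|z [D1z D0z]].
    by split; [exists z|case].
  by apply: contrapT => Ez; apply: D0z.
have mE : measurable E by rewrite ED; exact: measurableD.
split=> //; exists (B + B) => n n0.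
have D1E : D1 = E `|` D0.
  apply/seteqP; split=> [z D1z|z [Ez|[]//]]; last by exists z.
  by have [Ez|Ez] := pselect (E z); [left|right].
have ED0 : E `&` D0 = set0 by apply/seteqP; split=> // z [Ez []].
have := real_pullbackU n mb mE mD0 ED0; rewrite -D1E => pU.
have -> : real_pullback n m E = real_pullback n m D1 - real_pullback n m D0.
  by rewrite pU addrK.
rewrite mulrDl (le_trans (ler_normB _ _))// lerD//.
  exact: initial_segment_bound mD1 D1down.
exact: initial_segment_bound mD0 D0down.
Qed.

(** Since p and q are not in C, the open and the closed arc from p to q have the same trace on C.
    This trace is relatively open and closed, hence all of C as soon as it is nonempty. *)
Lemma connected_arc_dichotomy (C : set T) (p q : T) : connected C ->
  arg p < arg q -> ~ C p -> ~ C q ->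
  (forall z, C z -> arg p < arg z < arg q) \/
  (forall z, C z -> ~~ (arg p < arg z < arg q)).
Proof.
move=> Ccon pq Cp Cq.
have [noin|/existsNP[x /not_implyP[Cx /negP/negPn xin]]] :=
    pselect (forall z, C z -> ~~ (arg p < arg z < arg q)); [by right|left].
have CE : C `&` (@cis R @` `[arg p, arg q]%classic) = C.
  apply: Ccon.
  - exists x; split=> //; exists (arg x); last exact: argK.
    by rewrite /= in_itv/=; case/andP : xin => /ltW -> /ltW ->.
  - exists (~` ((@cis R @` `[0, arg p]%classic) `|`
        (@cis R @` `[arg q, 2 * pi]%classic))).
      by apply: closed_openC; apply: closedU; exact: closed_cis_itv.
    apply/seteqP; split=> z [Cz zz]; split=> //.
      case: zz => a /=; rewrite in_itv/= => /andP[pa aq] az.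
      have azE : arg z = a.
        by rewrite -az cisK// (le_trans (arg_ge0 p))// (le_lt_trans aq)// arg_lt2pi.
      have pz : arg p < arg z.
        rewrite lt_neqAle azE pa andbT; apply/eqP => pE; apply: Cp.
        by rewrite -(argK p) pE az.
      have zq : arg z < arg q.
        rewrite lt_neqAle azE aq andbT; apply/eqP => qE; apply: Cq.
        by rewrite -(argK q) -qE az.
      case=> -[b /=]; rewrite in_itv/= => /andP[b1 b2] bz.
        move: pz; rewrite -bz cisK ?b1 ?(le_lt_trans b2) ?arg_lt2pi//.
        by rewrite ltNge b2.
      have [b2'|b2'] := ltP b (2 * pi).
        move: zq; rewrite -bz cisK ?b2' ?andbT ?(le_trans (arg_ge0 q))//.
        by rewrite ltNge b1.
      (* The angle 2 pi gives the point 1 again, whose [arg] is 0 and so cannot exceed [arg p]. *)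
      have bE : b = 2 * pi by apply/eqP; rewrite eq_le b2.
      move: pz; rewrite -bz bE cis2pi -cis0 cisK ?lexx ?mulr_gt0 ?pi_gt0//.
      by rewrite ltNge arg_ge0.
    exists (arg z); last exact: argK.
    rewrite /= in_itv/=; apply/andP; split; rewrite leNgt; apply/negP => zlt.
      apply: zz; left; exists (arg z); last exact: argK.
      by rewrite /= in_itv/= arg_ge0 ltW.
    apply: zz; right; exists (arg z); last exact: argK.
    by rewrite /= in_itv/= !ltW// arg_lt2pi.
  - by exists (@cis R @` `[arg p, arg q]%classic) => //; exact: closed_cis_itv.
move=> z; rewrite -{1}CE => -[Cz [a /=]]; rewrite in_itv/= => /andP[pa aq] az.
have azE : arg z = a.
  by rewrite -az cisK// (le_trans (arg_ge0 p))// (le_lt_trans aq)// arg_lt2pi.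
rewrite !lt_neqAle azE pa aq !andbT; apply/andP; split; apply/eqP => E.
  by apply: Cp; rewrite -(argK p) E az.
by apply: Cq; rewrite -(argK q) -E az.
Qed.

(** If both fail, there are x < p < y in angle with only p outside C, and a < q < b with only q
    inside C. Cutting at a and b puts C between them, so a < x; cutting at a and p then separates x
    from y. *)
Lemma connected_arg_convex (C : set T) : connected C ->
  arg_convex C \/ arg_convex (~` C).
Proof.
move=> Ccon; apply: contrapT => /not_orP[nC nC'].
have [x [y [p [Cx Cy Cp xp py]]]] : exists x y p,
    [/\ C x, C y, ~ C p, arg x < arg p & arg p < arg y].
  move/existsNP : nC => [x /existsNP[y /existsNP[p]]].
  move=> /not_implyP[Cx /not_implyP[Cy /not_implyP[xp /not_implyP[py Cp]]]].
  exists x, y, p; split=> //; rewrite lt_neqAle ?xp ?py andbT; apply/eqP => E.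
    by apply: Cp; rewrite -(argK p) -E argK.
  by apply: Cp; rewrite -(argK p) E argK.
have [a [b [q [Ca Cb Cq aq qb]]]] : exists a b q,
    [/\ ~ C a, ~ C b, C q, arg a < arg q & arg q < arg b].
  move/existsNP : nC' => [a /existsNP[b /existsNP[q]]].
  move=> /not_implyP[Ca /not_implyP[Cb /not_implyP[aq /not_implyP[qb /contrapT Cq]]]].
  exists a, b, q; split=> //; rewrite lt_neqAle ?aq ?qb andbT; apply/eqP => E.
    by apply: Ca; rewrite -(argK a) E argK.
  by apply: Cb; rewrite -(argK b) -E argK.
have [Cab|Cab] := connected_arc_dichotomy Ccon (lt_trans aq qb) Ca Cb; last first.
  by have := Cab _ Cq; rewrite aq qb.
have /andP[ax _] := Cab _ Cx.
have [Cap|Cap] := connected_arc_dichotomy Ccon (lt_trans ax xp) Ca Cp.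
  by have /andP[_] := Cap _ Cy; rewrite ltNge ltW.
by have := Cap _ Cx; rewrite ax xp.
Qed.

(** Pull-backs have total mass 0, so passing from C to its complement only changes the sign and the
    same constant serves. *)
Lemma connected_pullback_bound m (C : set T) : bounded_content m ->
  connected C -> measurable C /\ exists K, forall n, (0 < n)%N ->
    `|real_pullback n m C| <= K / n%:R.
Proof.
move=> mb /connected_arg_convex[/(arg_convex_bound mb)//|].
move=> /(arg_convex_bound mb)[mC [K CK]].
have mC' : measurable C by rewrite -(setCK C); exact: measurableC.
split=> //; exists K => n n0.
have := real_pullbackU n mb mC' mC (setICr C).
rewrite setUCr real_pullbackT// => /eqP; rewrite eq_sym addr_eq0 => /eqP ->.
by rewrite normrN CK.
Qed.

End contents.

(** * Averages over rotations *)

Section averages.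
Variable R : realType.
Local Notation T := (circle R).
Implicit Types (m : set T -> R) (A E : set T) (z w zeta : T).

Lemma circle_powD k l z :
  circle_pow (k + l) z = circle_mul (circle_pow k z) (circle_pow l z).
Proof. by apply: circle_val_inj; rewrite /= exprD. Qed.

Lemma circle_powMl n z w :
  circle_pow n (circle_mul z w) = circle_mul (circle_pow n z) (circle_pow n w).
Proof. by apply: circle_val_inj; rewrite /= exprMn. Qed.

Lemma circle_mulI w : injective (fun z => circle_mul z w).
Proof.
have w0 : circle_val w != 0 by rewrite -normr_eq0 circle_val1 oner_eq0.
by move=> x y /(congr1 (@circle_val R))/(mulIf w0)/circle_val_inj.
Qed.

Lemma circle_mul1 w : circle_mul (circle_one R) w = w.
Proof. by apply: circle_val_inj; rewrite /= mul1r. Qed.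

Lemma finite_circle_roots n : (0 < n)%N -> finite_set (@circle_roots R n).
Proof.
move=> n0; rewrite (_ : circle_roots n =
    @circle_val R @^-1` [set x : R[i] | x ^+ n = 1]).
  by apply: finite_preimage (finite_unity_roots R n0) => x y _ _ /circle_val_inj.
apply/seteqP; split=> z /= => [/(congr1 (@circle_val R))//|zn].
exact: circle_val_inj.
Qed.

Lemma set_bij_circle_roots n M : (0 < M)%N -> coprime n M ->
  set_bij (@circle_roots R n) (@circle_roots R n) (circle_pow M).
Proof.
move=> M0 /(coprime_inv_mod M0)[k [j kj]].
have pow1 l : circle_pow l (circle_one R) = circle_one R.
  by apply: circle_val_inj; rewrite /= expr1n.
have inv z : circle_roots n z -> circle_pow (k * M) z = z.
  move=> zn; rewrite kj circle_powD [(j * n)%N]mulnC -circle_powM zn pow1 circle_mul1.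
  by apply: circle_val_inj; rewrite /= expr1.
have stable l z : circle_roots n z -> circle_roots n (circle_pow l z).
  by move=> zn; rewrite /circle_roots/= circle_powM mulnC -circle_powM zn.
split=> [z|x y /set_mem xn /set_mem yn xy|z zn]; first exact: stable.
- by rewrite -(inv _ xn) -(inv _ yn) mulnC -!circle_powM xy.
- by exists (circle_pow k z); [exact: stable|rewrite circle_powM inv].
Qed.

Definition real_avg n m A : R :=
  n%:R^-1 * \sum_(zeta \in circle_roots n) m (circle_mul zeta @^-1` A).

Lemma real_avgE n m A : (0 < n)%N -> real_avg n m A =
  n%:R^-1 * \sum_(zeta <- fset_set (circle_roots n)) m (circle_mul zeta @^-1` A).
Proof. by move=> n0; rewrite /real_avg fsbig_finite//; exact: finite_circle_roots. Qed.

Lemma mem_circle_roots n zeta : (0 < n)%N ->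
  zeta \in fset_set (circle_roots n) -> circle_roots n zeta.
Proof. by move=> n0; rewrite in_fset_set ?inE//; exact: finite_circle_roots. Qed.

Lemma measurable_rotation zeta A : measurable A ->
  measurable (circle_mul zeta @^-1` A).
Proof.
by move=> mA; rewrite -[_ @^-1` _]setTI; exact: measurable_circle_mul.
Qed.

Definition pow_invariant M m :=
  forall A, measurable A -> m (circle_pow M @^-1` A) = m A.

(** The fibres of the power map are the orbits of the roots of unity; [cis (arg z - arg w)] is the
    quotient z / w. *)
Lemma pow_preimage_image M k A : (0 < M)%N -> (k < M)%N ->
  circle_pow M @^-1` (circle_pow M @` (A `&` circle_sector M k)) =
  \bigcup_(zeta in circle_roots M) circle_mul zeta @^-1` (A `&` circle_sector M k).
Proof.
move=> M0 kM; apply/seteqP; split=> [w [z Az zw]|w [zeta zetaM Aw]]; last first.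
  exists (circle_mul zeta w) => //.
  by rewrite circle_powMl zetaM circle_mul1.
have mulE : circle_mul (cis (arg z - arg w)) w = z.
  by rewrite -{2}(argK w) -cisD subrK argK.
exists (cis (arg z - arg w)); last by rewrite /preimage/= mulE.
apply: (@circle_mulI (circle_pow M w)).
by rewrite -circle_powMl mulE zw circle_mul1.
Qed.

(** This is M^* m = e_M m. Invariance replaces the image of each piece A cut by sector k by its full
    preimage, the union of the rotates of that piece. These are disjoint since the power is
    injective on the sector, and summing over k first reassembles each rotate of A. *)
Lemma real_pullback_avg M m A : (0 < M)%N -> bounded_content m ->
  pow_invariant M m -> measurable A -> real_pullback M m A = real_avg M m A.
Proof.
move=> M0 mb minv mA; rewrite real_avgE// /real_pullback; congr (_ * _).
have rootsE : [set` fset_set (@circle_roots R M)] = circle_roots M.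
  by rewrite fset_setK//; exact: finite_circle_roots.
have mAk k : (k < M)%N -> measurable (A `&` circle_sector M k).
  by move=> kM; apply: measurableI => //; exact: measurable_circle_sector.
transitivity (\sum_(0 <= k < M) \sum_(zeta <- fset_set (circle_roots M))
    m (circle_mul zeta @^-1` (A `&` circle_sector M k))).
  rewrite [LHS]big_seq [RHS]big_seq; apply: eq_bigr => k.
  rewrite mem_index_iota0 => kM.
  rewrite -minv ?pow_preimage_image//; last exact: measurable_sector_image.
  rewrite -[in LHS]rootsE bounded_content_bigU// ?fset_uniq//.
    by move=> zeta _; apply: measurable_rotation; exact: mAk.
  move=> zeta eta /(mem_circle_roots M0) zM /(mem_circle_roots M0) eM.
  move=> [w [[_ zk] [_ ek]]]; apply: (@circle_mulI w).
  apply: (circle_pow_sector_inj kM) => //.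
  by rewrite !circle_powMl zM eM.
rewrite exchange_big/=; apply: eq_bigr => zeta _.
rewrite -bounded_content_bigU ?iota_uniq//.
- congr m; apply/seteqP; split=> [w [k _ [Aw _]]//|w Aw].
  have [k kM wk] := circle_sector_cover (circle_mul zeta w) M0.
  by exists k => //=; rewrite mem_index_iota0.
- by move=> k; rewrite mem_index_iota0 => kM; apply: measurable_rotation; exact: mAk.
- move=> k l; rewrite !mem_index_iota0 => kM lM [w [[_ wk] [_ wl]]].
  exact: circle_sector_uniq wk wl.
Qed.

Lemma bounded_contentB_avg n m : (0 < n)%N -> bounded_content m ->
  bounded_content (fun A => m A - real_avg n m A).
Proof.
move=> n0 [mT mU [B mB]]; split.
- rewrite real_avgE// big1 => [|zeta _]; last exact: mT.
  by rewrite mT mulr0 subr0.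
- move=> A E mA mE AE; rewrite !real_avgE// mU//.
  rewrite [RHS]addrACA -opprD -mulrDr -big_split/=; congr (_ - (_ * _)).
  apply: eq_bigr => zeta _; rewrite preimage_setU mU//.
  + exact: measurable_rotation.
  + exact: measurable_rotation.
  + by rewrite -preimage_setI AE preimage_set0.
- exists (B + n%:R^-1 * \sum_(zeta <- fset_set (@circle_roots R n)) B) => A mA.
  rewrite real_avgE// (le_trans (ler_normB _ _))// lerD ?mB//.
  rewrite normrM ger0_norm ?invr_ge0// ler_wpM2l ?invr_ge0//.
  rewrite (le_trans (ler_norm_sum _ _ _))// ler_sum// => zeta _.
  by apply: mB; exact: measurable_rotation.
Qed.

(** The M-th power carries rotation by zeta to rotation by zeta^M, and zeta |-> zeta^M permutes the
    n-th roots of unity by coprimality. *)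
Lemma pow_invariantB_avg n M m : (0 < n)%N -> (0 < M)%N -> coprime n M ->
  pow_invariant M m -> pow_invariant M (fun A => m A - real_avg n m A).
Proof.
move=> n0 M0 nM minv A mA; rewrite minv//; congr (_ - _).
rewrite /real_avg; congr (_ * _).
rewrite [RHS](@reindex_fsbig _ _ _ _ _ _ _ _ _ (set_bij_circle_roots M0 nM)).
apply: eq_fsbigr => zeta _.
rewrite -[RHS]minv; last exact: measurable_rotation.
by congr m; apply/seteqP; split=> w; rewrite /preimage/= circle_powMl.
Qed.

Local Open Scope ereal_scope.

Lemma meas_avg_real n m (sigma : set T -> \bar R) : (0 < n)%N ->
  (forall A, measurable A -> sigma A = (m A)%:E) ->
  forall A, measurable A -> meas_avg n sigma A = (real_avg n m A)%:E.
Proof.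
move=> n0 sm A mA; rewrite real_avgE// /meas_avg EFinM; congr (_ * _).
rewrite fsbig_finite//=; last exact: finite_circle_roots.
rewrite -sumEFin; apply: eq_bigr => zeta _.
by rewrite /pushforward sm//; exact: measurable_rotation.
Qed.

Lemma meas_pullback_real n m (sigma : set T -> \bar R) : (0 < n)%N ->
  (forall A, measurable A -> sigma A = (m A)%:E) ->
  forall A, measurable A -> meas_pullback n sigma A = (real_pullback n m A)%:E.
Proof.
move=> n0 sm A mA; rewrite /meas_pullback EFinM; congr (_ * _).
rewrite -sumEFin [LHS]big_seq [RHS]big_seq; apply: eq_bigr => k.
rewrite mem_index_iota0 => kn.
by rewrite sm//; exact: measurable_sector_image.
Qed.

Lemma Omega_meas_real (N : nat -> nat) M t m (sigma : set T -> \bar R) :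
  (0 < M)%N -> (forall i, (1 <= i <= t)%N -> (0 < N i)%N /\ coprime (N i) M) ->
  bounded_content m -> pow_invariant M m ->
  (forall A, measurable A -> sigma A = (m A)%:E) ->
  exists m', [/\ bounded_content m', pow_invariant M m' &
    forall A, measurable A -> Omega_meas N t sigma A = (m' A)%:E].
Proof.
move=> M0 NM mb minv sm; elim: t NM => [_|t IH NM]; first by exists m.
have [|m' [m'b m'inv Om']] := IH.
  by move=> i /andP[i1 it]; apply: NM; rewrite i1 leqW.
have [N0 NtM] := NM t.+1 (introT andP (conj (ltn0Sn t) (leqnn t.+1))).
exists (fun A => (m' A - real_avg (N t.+1) m' A)%R); split.
- exact: bounded_contentB_avg.
- exact: pow_invariantB_avg.
- by move=> A mA /=; rewrite (meas_avg_real N0 Om')// Om'.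
Qed.

Lemma charge_bounded_content (sigma : {charge set T -> \bar R}) :
  sigma setT = 0 -> bounded_content (fun A => fine (sigma A)).
Proof.
move=> s0; have fin A : measurable A -> sigma A \is a fin_num.
  by move=> mA; exact: fin_num_measure.
split; first by rewrite s0.
- move=> A E mA mE AE; rewrite -fineD; [|exact: fin..].
  by rewrite chargeU.
(* The bound is the total variation of the charge, which is finite on the whole circle. *)
- have [P [N PN]] := Hahn_decomposition sigma.
  exists (fine (charge_variation PN setT)) => A mA.
  rewrite -lee_fin -abse_EFin fineK ?fin//.
  apply: (le_trans (abse_charge_variation PN mA)).
  rewrite fineK; last exact: fin_num_measure.
  by apply: le_measure; rewrite ?inE.
Qed.

End averages.

(** * Telescoping series of measures *)

Section measure_series.
Variable R : realType.
Local Notation T := (circle R).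

(** Additive counterpart of [limn_mul_cvg1]: both sequences have the same set of limits in [\bar R],
    so [lim] makes the same choice. The null sequence is real, which makes every extended sum well
    defined. *)
Lemma limn_EFin_add_cvg0 (a b e : nat -> R) : (forall k, a k = b k + e k) ->
  e @ \oo --> 0 -> limn (fun k => (a k)%:E) = limn (fun k => (b k)%:E).
Proof.
move=> abe e0; rewrite /lim /lim_in; congr (get _).
have EFin_cvg0 (x : nat -> R) :
    x @ \oo --> 0 -> (fun k => (x k)%:E) @ \oo --> 0%E.
  by move=> x0; apply: cvg_EFin => //; exact: nearW.
have e0' := EFin_cvg0 _ e0.
have Ne0' : (fun k => (- e k)%:E) @ \oo --> 0%E.
  by apply: EFin_cvg0; rewrite -oppr0; exact: cvgN.
apply/funext => l; apply/propext; split=> [al|bl].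
  rewrite -[l]adde0 (_ : (fun k => _) = fun k => ((a k)%:E + (- e k)%:E)%E).
    by apply: cvgeD => //; rewrite fin_num_adde_defl.
  by apply/funext => k; rewrite abe -EFinD addrK.
rewrite -[l]adde0 (_ : (fun k => _) = fun k => ((b k)%:E + (e k)%:E)%E).
  by apply: cvgeD => //; rewrite fin_num_adde_defl.
by apply/funext => k; rewrite abe EFinD.
Qed.

(** The partial sums are monotone and bounded, hence convergent; the block is at most the difference
    of two of them, both within e / 2 of the limit. *)
Lemma cvg_sum_inv_gen_monoid_tail (N : nat -> nat) t M (P : pred nat) :
  pairwise_coprime_gen N t -> (0 < M)%N ->
  (fun k => \sum_(k <= n < k * M | (n \in gen_monoid N t) && P n) n%:R^-1 : R)
    @ \oo --> 0.
Proof.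
move=> Nt M0.
pose A k : R := \sum_(0 <= n < k | n \in gen_monoid N t) n%:R^-1.
have split_A k l : (k <= l)%N ->
    A l = A k + \sum_(k <= n < l | n \in gen_monoid N t) n%:R^-1.
  by move=> kl; rewrite /A (big_cat_nat (n := k)).
have sum_ge0 k l (Q : pred nat) : 0 <= \sum_(k <= n < l | Q n) n%:R^-1 :> R.
  by apply: sumr_ge0 => n _; rewrite invr_ge0.
have A_ndecr : nondecreasing_seq A.
  by move=> k l kl; rewrite (split_A _ _ kl) lerDl.
have A_ub : has_ubound (range A).
  by exists (2 ^+ t) => _ [k _ <-]; exact: sum_inv_gen_monoid_le.
have /cvgrPdist_lt Acvg := nondecreasing_is_cvgn A_ndecr A_ub.
apply/cvgrPdist_lt => e e0.
have e20 : 0 < e / 2 by rewrite divr_gt0.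
have [k0 _ Ak0] := Acvg _ e20.
exists k0 => // k /= k0k; rewrite sub0r normrN ger0_norm//.
have kkM : (k <= k * M)%N by rewrite leq_pmulr.
apply: (@le_lt_trans _ _ (A (k * M)%N - A k)).
  rewrite (split_A _ _ kkM) addrC addKr big_mkcond [leRHS]big_mkcond/=.
  apply: ler_sum => n _; case: (n \in gen_monoid N t) => //=.
  by case: (P n) => //; rewrite invr_ge0.
have AkM := Ak0 _ (leq_trans k0k kkM); have Ak := Ak0 _ k0k.
apply: le_lt_trans (ler_norm _) _.
rewrite -(subrK (limn A) (A (k * M)%N)) -addrA (le_lt_trans (ler_normD _ _))//.
by rewrite (splitr e) ltrD// distrC.
Qed.

Lemma Psi_meas_prev (N : nat -> nat) t (m : set T -> R)
    (tau : set T -> \bar R) (C : set T) :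
  pairwise_coprime_gen N t.+1 -> bounded_content m ->
  pow_invariant (N t.+1) m ->
  (forall A, measurable A -> tau A = (m A)%:E) -> connected C ->
  Psi_meas N t tau C =
  Psi_meas N t.+1 (fun A => tau A - meas_avg (N t.+1) tau A)%E C.
Proof.
move=> Nt mb minv taum Ccon.
have M0 : (0 < N t.+1)%N := ltnW (last_gen_gt1 Nt).
have [mC [K CK]] := connected_pullback_bound mb Ccon.
pose P n := real_pullback n m C.
have taum' A : measurable A ->
    (tau A - meas_avg (N t.+1) tau A)%E = (m A - real_avg (N t.+1) m A)%:E.
  by move=> mA; rewrite (meas_avg_real M0 taum)// taum.
have -> : Psi_meas N t tau C =
    limn (fun k => (\sum_(0 <= n < k | n \in gen_monoid N t) P n)%:E).
  congr (limn _); apply/funext => k; rewrite -sumEFin.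
  apply: eq_bigr => n; rewrite inE => Sn.
  have n0 := gen_monoid_gt0 (pairwise_coprime_genW Nt) Sn.
  exact: meas_pullback_real.
have -> : Psi_meas N t.+1 (fun A => tau A - meas_avg (N t.+1) tau A)%E C =
    limn (fun k => (\sum_(0 <= n < k | n \in gen_monoid N t.+1)
      (P n - P (n * N t.+1)%N))%:E).
  congr (limn _); apply/funext => k; rewrite -sumEFin.
  apply: eq_bigr => n; rewrite inE => /(gen_monoid_gt0 Nt) n0.
  rewrite (meas_pullback_real n0 taum')// real_pullbackB /P -real_pullbackM//.
  (* The identity M^* m = e_M m is known on measurable sets only, and n^* evaluates it on sector
     images, which are measurable. *)
  congr ((_ - _)%:E); apply: eq_real_pullback => // A mA.
  by rewrite real_pullback_avg.
apply: (@limn_EFin_add_cvg0 _ _ (fun k => \sum_(k <= n < k * N t.+1 |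
    (n \in gen_monoid N t.+1) && (N t.+1 %| n)%N) P n)).
  move=> k; rewrite big_split/= sumrN addrAC.
  by rewrite (big_gen_monoid_telescope Nt) addrK.
have K0 : 0 <= K by have := CK 1%N isT; rewrite divr1; apply: le_trans.
apply/norm_cvg0P.
apply: (@squeeze_cvgr _ _ _ _ (cst 0) (fun k => K * \sum_(k <= n < k * N t.+1 |
    (n \in gen_monoid N t.+1) && (N t.+1 %| n)%N) n%:R^-1)).
- apply: nearW => k /=; rewrite normr_ge0/= mulr_sumr.
  rewrite (le_trans (ler_norm_sum _ _ _))// ler_sum// => n /andP[].
  by rewrite inE => /(gen_monoid_gt0 Nt) n0 _; exact: CK.
- exact: cvg_cst.
- have := cvgM (cvg_cst K)
    (cvg_sum_inv_gen_monoid_tail (fun n => N t.+1 %| n)%N Nt M0).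
  by rewrite mulr0; exact.
Qed.

End measure_series.

Unset Implicit Arguments.

Theorem proposition52 (R : realType) (s : nat) (N : nat -> nat)
  (hs : (1 <= s)%N)
  (hN : forall i, (1 <= i <= s)%N -> (2 <= N i)%N)
  (hcoprime : forall i j, (1 <= i <= s)%N -> (1 <= j <= s)%N -> i != j ->
    coprime (N i) (N j)) :
  (forall sigma : {charge set (circle R) -> \bar R},
     sigma [set: circle R] = 0%E ->
     (forall A : set (circle R), measurable A ->
        pushforward sigma (circle_pow (N s)) A = sigma A) ->
     forall C : set (circle R), connected C ->
       Psi_meas N s.-1 (Omega_meas N s.-1 sigma) C =
       Psi_meas N s (Omega_meas N s sigma) C) /\
  (forall u : R[i] -> R[i],
     nevanlinna1 u ->
     (forall z : R[i], disc z -> u (z ^+ N s) ^+ N s = rotation_prod (N s) u z) ->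
     forall z : R[i], disc z ->
       Psi_fun N s.-1 (Omega_fun N s.-1 u) z = Psi_fun N s (Omega_fun N s u) z).
Proof.
(* With s written [t.+1], [s.-1] reduces to t and the operator for S is, by computation, the one for
   S' followed by the factor of the last generator. *)
case: s hs hN hcoprime => // t _ hN hcoprime.
have Nt : pairwise_coprime_gen N t.+1 by split.
have M0 : (0 < N t.+1)%N := ltnW (last_gen_gt1 Nt).
have NM i : (1 <= i <= t)%N -> (0 < N i)%N /\ coprime (N i) (N t.+1).
  move=> it; split; last by apply: (coprime_gen_monoid Nt); exact: gen_monoid_gen.
  by apply: (gen_monoid_gt0 (pairwise_coprime_genW Nt)); exact: gen_monoid_gen.
split=> [sigma sigmaT sigmaM C Ccon|u u1 ueq z z1].
  have sigmaE A : measurable A -> sigma A = (fine (sigma A))%:E.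
    by move=> mA; rewrite fineK// fin_num_measure.
  have sigma_inv : pow_invariant (N t.+1) (fun A => fine (sigma A)).
    by move=> A mA; congr fine; exact: sigmaM.
  have [m [mb minv Om]] := Omega_meas_real M0 NM
    (charge_bounded_content sigmaT) sigma_inv sigmaE.
  exact: Psi_meas_prev Nt mb minv Om Ccon.
have [nv veq] := Omega_fun_functional_eq M0 NM (nevanlinna1_normalized u1) ueq.
apply: (Psi_fun_prev Nt nv _ z1).
exact: fun_avg_functional_eq.
Qed.
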